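(* Consider the model $y=X\beta^*+W$ with $M\ge2$, $N\ge1$, where $W\in\mathbb{R}^N$ has i.i.d. $\mathcal{N}(0,\sigma^2)$ components, $\sigma^2>0$. Let $q>0$ and, for every $j\in\mathbb{N}_M$, $$\lambda_j\ \ge\ \frac{2\sigma}{\sqrt N}\sqrt{\mathrm{tr}(\Psi_j)+2\,|||\Psi_j|||\,\bigl(2q\log M+\sqrt{K_j\,q\log M}\bigr)}.$$ Assume that $M(\beta^* )\le s$ and that Assumption RE($s$) holds, and let the Coherence Assumption hold with the same $s$ and with constants $\alpha>1$ and $\phi>0$. Set $$c=\frac32+\frac{16}{7(\alpha-1)}.$$ Then with probability at least $1-2M^{1-q}$, for any solution $\hat\beta$ of the Group Lasso problem (GL) we have $$\|\hat\beta-\beta^*\|_{2,\infty}\le\frac c\phi\lambda_{\max}.$$ If, in addition, $$\min_{j\in J(\beta^* )}\|(\beta^* )^j\|>\frac{2c}\phi\lambda_{\max},$$ then with the same probability for any solution $\hat\beta$ of (GL) the set of indices $$\hat J=\Bigl\{j:\ \|\hat\beta^j\|>\frac c\phi\lambda_{\max}\Bigr\}$$ estimates correctly the sparsity pattern $J(\beta^* )$, that is, $\hat J=J(\beta^* )$.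
   Context: For a positive integer $\ell$, $\mathbb{N}_\ell=\{1,\dots,\ell\}$. Let $M\le K$ and let $G_1,\dots,G_M$ be a prescribed partition of $\mathbb{N}_K$, with $K_j=|G_j|$. $X$ is a deterministic real $N\times K$ matrix, $\mathbf{X}_{G_j}$ is the $N\times K_j$ submatrix of columns indexed by $G_j$, $\Psi_j=\mathbf{X}_{G_j}^\top\mathbf{X}_{G_j}/N$, and $\Psi[j,j']=\frac1N\mathbf{X}_{G_j}^\top\mathbf{X}_{G_{j'}}$, with $(t,t')$ entry $(\Psi[j,j'])_{t,t'}$, $t\in\mathbb{N}_{K_j}$, $t'\in\mathbb{N}_{K_{j'}}$. For a symmetric positive semidefinite $A$, $\mathrm{tr}(A)$ is the trace and $|||A|||$ the spectral norm. For $\beta\in\mathbb{R}^K$: $\beta^j=(\beta_k:k\in G_j)$; $\|\cdot\|$ is the Euclidean norm; $\|\beta\|_{2,\infty}=\max_{1\le j\le M}\|\beta^j\|$; $J(\beta)=\{j\in\mathbb{N}_M:\beta^j\ne0\}$; $M(\beta)=|J(\beta)|$. For $J\subseteq\mathbb{N}_M$, $\beta_J$ has blocks $\beta^j$ for $j\in J$ and $0$ for $j\notin J$; $J^c=\mathbb{N}_M\setminus J$. Group Lasso problem (GL), with positive parameters $\lambda_1,\dots,\lambda_M$; $\lambda_{\min}=\min_j\lambda_j$, $\lambda_{\max}=\max_j\lambda_j$: $$\min\Bigl\{\frac1N\|X\beta-y\|^2+2\sum_{j=1}^M\lambda_j\|\beta^j\|:\ \beta\in\mathbb{R}^K\Bigr\}.$$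 $s$ is an integer, $1\le s\le M$. Assumption RE($s$): there exists $\kappa=\kappa(s)>0$ such that $$\min\Bigl\{\frac{\|X\Delta\|}{\sqrt N\|\Delta_J\|}:\ |J|\le s,\ \Delta\in\mathbb{R}^K\setminus\{0\},\ \sum_{j\in J^c}\lambda_j\|\Delta^j\|\le3\sum_{j\in J}\lambda_j\|\Delta^j\|\Bigr\}\ge\kappa .$$ Coherence Assumption (with $s$, $\alpha$, $\phi$): (1) for any $j\in\mathbb{N}_M$ and $t\in\mathbb{N}_{K_j}$, $(\Psi[j,j])_{t,t}=\phi$, and $$\max_{1\le t,t'\le K_j,\,t\ne t'}|(\Psi[j,j])_{t,t'}|\le\frac{\lambda_{\min}\phi}{14\alpha\lambda_{\max}s}\,\frac1{K_j};$$ (2) for any $j\ne j'\in\mathbb{N}_M$, $$\max_{1\le t\le\min(K_j,K_{j'})}|(\Psi[j,j'])_{t,t}|\le\frac{\lambda_{\min}\phi}{14\alpha\lambda_{\max}s}$$ and $$\max_{1\le t\le K_j,\,1\le t'\le K_{j'},\,t\ne t'}|(\Psi[j,j'])_{t,t'}|\le\frac{\lambda_{\min}\phi}{14\alpha\lambda_{\max}s}\,\frac1{\sqrt{K_jK_{j'}}}.$$ *)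

(* Defs.v *)
From HB Require Import structures.
From mathcomp Require Import all_boot all_order all_algebra.
From mathcomp Require Import all_classical all_reals all_analysis.

Set Implicit Arguments.
Unset Strict Implicit.
Unset Printing Implicit Defensive.

Import Order.TTheory GRing.Theory Num.Theory.
Import numFieldNormedType.Exports.

Local Open Scope ring_scope.

(* The norm `|v| that MathComp-Analysis puts on matrices is the sup norm, hence
   the explicit Euclidean norm here and the operator norm derived from it. *)
Definition enorm (R : realType) (n : nat) (v : 'cV[R]_n) : R :=
  Num.sqrt (\sum_(i < n) v i 0 ^+ 2).

Definition spectral_norm (R : realType) (n : nat) (A : 'M[R]_n) : R :=
  sup [set enorm (A *m v) | v in [set v : 'cV[R]_n | enorm v <= 1]]%classic.

Definition group_partition (M K : nat) (G : 'I_M -> {set 'I_K}) : Prop :=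
  injective G /\ finset.partition [set G j | j : 'I_M]%SET [set: 'I_K]%SET.

(* [enum_val] lists the elements of a set of ordinals in increasing order: this
   fixes which column of X is the t-th one of its group. *)
Definition block (R : realType) (M K : nat) (G : 'I_M -> {set 'I_K})
    (b : 'cV[R]_K) (j : 'I_M) : 'cV[R]_#|G j| :=
  rowsub (fun t : 'I_#|G j| => enum_val t) b.

Definition subdesign (R : realType) (M K N : nat) (G : 'I_M -> {set 'I_K})
    (X : 'M[R]_(N, K)) (j : 'I_M) : 'M[R]_(N, #|G j|) :=
  colsub (fun t : 'I_#|G j| => enum_val t) X.

Definition gram (R : realType) (M K N : nat) (G : 'I_M -> {set 'I_K})
    (X : 'M[R]_(N, K)) (j j' : 'I_M) : 'M[R]_(#|G j|, #|G j'|) :=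
  N%:R^-1 *: ((subdesign G X j)^T *m subdesign G X j').

Definition norm2inf (R : realType) (M K : nat) (G : 'I_M -> {set 'I_K})
    (b : 'cV[R]_K) : R :=
  \big[Num.max/0]_(j < M) enorm (block G b j).

Definition active_groups (R : realType) (M K : nat) (G : 'I_M -> {set 'I_K})
    (b : 'cV[R]_K) : {set 'I_M} :=
  [set j | block G b j != 0]%SET.

Definition restrict_groups (R : realType) (M K : nat) (G : 'I_M -> {set 'I_K})
    (J : {set 'I_M}) (b : 'cV[R]_K) : 'cV[R]_K :=
  \col_k (if [exists j in J, k \in G j] then b k 0 else 0).

(* The default values of the iterated max and min are immaterial for a nonempty
   family of positive parameters. *)
Definition lambda_max (R : realType) (M : nat) (lambda : 'I_M -> R) : R :=
  \big[Num.max/0]_(j < M) lambda j.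

Definition lambda_min (R : realType) (M : nat) (lambda : 'I_M -> R) : R :=
  \big[Num.min/lambda_max lambda]_(j < M) lambda j.

Definition group_lasso_objective (R : realType) (M K N : nat)
    (G : 'I_M -> {set 'I_K}) (X : 'M[R]_(N, K)) (lambda : 'I_M -> R)
    (y : 'cV[R]_N) (b : 'cV[R]_K) : R :=
  N%:R^-1 * enorm (X *m b - y) ^+ 2
    + 2 * \sum_(j < M) lambda j * enorm (block G b j).

Definition group_lasso_solution (R : realType) (M K N : nat)
    (G : 'I_M -> {set 'I_K}) (X : 'M[R]_(N, K)) (lambda : 'I_M -> R)
    (y : 'cV[R]_N) (b : 'cV[R]_K) : Prop :=
  forall b' : 'cV[R]_K,
    group_lasso_objective G X lambda y b
      <= group_lasso_objective G X lambda y b'.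

(* For positive lambda the cone condition and D != 0 force D_J != 0, so the
   denominator never vanishes. *)
Definition assumption_RE (R : realType) (M K N : nat)
    (G : 'I_M -> {set 'I_K}) (X : 'M[R]_(N, K)) (lambda : 'I_M -> R)
    (s : nat) : Prop :=
  exists2 kappa : R, 0 < kappa &
    forall (J : {set 'I_M}) (D : 'cV[R]_K),
      (#|J| <= s)%N -> D != 0 ->
      \sum_(j | j \notin J) lambda j * enorm (block G D j)
        <= 3 * \sum_(j in J) lambda j * enorm (block G D j) ->
      kappa <= enorm (X *m D)
                 / (Num.sqrt N%:R * enorm (restrict_groups G J D)).

Definition coherence_level (R : realType) (M : nat) (lambda : 'I_M -> R)
    (s : nat) (alpha phi : R) : R :=
  lambda_min lambda * phi / (14 * alpha * lambda_max lambda * s%:R).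

Definition coherence_assumption (R : realType) (M K N : nat)
    (G : 'I_M -> {set 'I_K}) (X : 'M[R]_(N, K)) (lambda : 'I_M -> R)
    (s : nat) (alpha phi : R) : Prop :=
  let delta := coherence_level lambda s alpha phi in
  (forall j : 'I_M,
     (forall t : 'I_#|G j|, gram G X j j t t = phi) /\
     (forall t t' : 'I_#|G j|, t != t' ->
        `|gram G X j j t t'| <= delta * (#|G j|%:R)^-1)) /\
  (forall j j' : 'I_M, j != j' ->
     (forall (t : 'I_#|G j|) (t' : 'I_#|G j'|), t = t' :> nat ->
        `|gram G X j j' t t'| <= delta) /\
     (forall (t : 'I_#|G j|) (t' : 'I_#|G j'|), t <> t' :> nat ->
        `|gram G X j j' t t'|
          <= delta * (Num.sqrt (#|G j|%:R * #|G j'|%:R))^-1)).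

Definition mutually_independent (d : measure_display) (T : measurableType d)
    (R : realType) (P : probability T R) (I : finType)
    (W : I -> {RV P >-> R}) : Prop :=
  forall (J : {set I}) (B : I -> set R),
    (forall i, measurable (B i)) ->
    P [set w | forall i, i \in J -> B i (W i w)]%classic
      = (\prod_(i in J) P (W i @^-1` B i)%classic)%E.

(* [normal_prob m s] has standard deviation s. *)
Definition iid_centered_normal (d : measure_display) (T : measurableType d)
    (R : realType) (P : probability T R) (N : nat) (sigma : R)
    (W : 'I_N -> {RV P >-> R}) : Prop :=
  mutually_independent W /\
  forall (i : 'I_N) (B : set R), measurable B ->
    distribution P (W i) B = normal_prob 0 sigma B.

(* The values of P on nonmeasurable sets are meaningless, so the property is
   required to hold on a measurable event of probability at least p; for a
   measurable E this amounts to p%:E <= P E. *)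
Definition with_probability_at_least (d : measure_display)
    (T : measurableType d) (R : realType) (P : probability T R) (p : R)
    (E : set T) : Prop :=
  exists A : set T,
    [/\ measurable A, (p%:E <= P A)%E & (A `<=` E)%classic].

(* Main.v *)
Require Import Defs.
From HB Require Import structures.
From mathcomp Require Import all_boot all_order all_algebra.
From mathcomp Require Import all_classical all_reals all_analysis.
From mathcomp Require Import measurable_realfun.
From mathcomp Require Import ring lra.
Import Order.TTheory GRing.Theory Num.Theory.
Import numFieldNormedType.Exports.
Import HBNNSimple.
Set Implicit Arguments.
Unset Strict Implicit.
Unset Printing Implicit Defensive.
Local Open Scope classical_set_scope.
Local Open Scope ring_scope.

(* On the event that |X_{G_j}^T W| <= N lambda_j / 2 for every group j, comparing
   the objective at the solution and at betastar gives, for D := b - betastar,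
     |X D|^2 / N + sum_j lambda_j |D^j| <= 4 sum_{j in J} lambda_j |D^j|,
   and stationarity gives |(Psi D)^j| <= 3 lambda_j / 2 with Psi := X^T X / N.
   Coherence makes Psi - phi I small as a form in the block norms. Hence
   |X D|^2 / N >= (1 - 1/alpha) phi |D_J|^2, so the first inequality bounds
   sum_j |D^j|, and the second one then bounds each phi |D^j|.

   The event has probability at least 1 - M^(1-q) by the Laurent-Massart bound
   for |X_{G_j}^T W|^2 = sum_k (a_k . W)^2, where the a_k are the images under
   X_{G_j} of an orthonormal eigenbasis of the Gram matrix and hence orthogonal.
   The moment generating function of this sum is computed without rotating W:
   exp(u^2/2) is the integral of exp(x u) against the standard normal law, and
   Fubini then trades one square for a linear term. *)

(** * Euclidean geometry *)

Section Euclidean.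
Variable R : realType.

(** Cauchy-Schwarz: the sum of the squares of [B * a i - C * b i] equals [B * (A * B - C ^+ 2)]. One
    divides by [B], or, when [B = 0], notes that every [b i] vanishes. *)
Lemma sum_mul_sqr_le (I : finType) (Q : pred I) (a b : I -> R) :
  (\sum_(i | Q i) a i * b i) ^+ 2
    <= (\sum_(i | Q i) a i ^+ 2) * (\sum_(i | Q i) b i ^+ 2).
Proof.
set A := \sum_(i | Q i) a i ^+ 2; set B := \sum_(i | Q i) b i ^+ 2.
set C := \sum_(i | Q i) a i * b i.
have B0 : 0 <= B by apply: sumr_ge0 => i _; exact: sqr_ge0.
have E x y : \sum_(i | Q i) (y * a i - x * b i) ^+ 2
    = y ^+ 2 * A - 2 * y * x * C + x ^+ 2 * B.
  rewrite !mulr_sumr -sumrB -big_split/=; apply: eq_bigr => i _; ring.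
have : 0 <= B * (A * B - C ^+ 2).
  have -> : B * (A * B - C ^+ 2) = B ^+ 2 * A - 2 * B * C * C + C ^+ 2 * B.
    by ring.
  by rewrite -E; apply: sumr_ge0 => i _; exact: sqr_ge0.
move: B0; rewrite le_eqVlt => /predU1P[B0 _|B0]; last first.
  by rewrite pmulr_rge0// subr_ge0.
have b0 i : Q i -> b i = 0.
  move=> Qi; apply/eqP; rewrite -sqrf_eq0.
  have /eqP := esym B0; rewrite psumr_eq0; last by move=> *; exact: sqr_ge0.
  by move=> /allP /(_ i); rewrite mem_index_enum => /(_ isT) /implyP; exact.
by rewrite /C big1 ?expr0n -?B0 ?mulr0// => i Qi; rewrite b0// mulr0.
Qed.

Definition dot (n : nat) (u v : 'cV[R]_n) : R := \sum_i u i 0 * v i 0.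

Lemma dotC n (u v : 'cV[R]_n) : dot u v = dot v u.
Proof. by apply: eq_bigr => i _; rewrite mulrC. Qed.

Lemma dotDl n (u v w : 'cV[R]_n) : dot (u + v) w = dot u w + dot v w.
Proof. by rewrite -big_split; apply: eq_bigr => i _; rewrite mxE mulrDl. Qed.

Lemma dotZl n a (u w : 'cV[R]_n) : dot (a *: u) w = a * dot u w.
Proof. by rewrite mulr_sumr; apply: eq_bigr => i _; rewrite mxE mulrA. Qed.

Lemma dotDr n (u v w : 'cV[R]_n) : dot w (u + v) = dot w u + dot w v.
Proof. by rewrite dotC dotDl !(dotC w). Qed.

Lemma dotZr n a (u w : 'cV[R]_n) : dot w (a *: u) = a * dot w u.
Proof. by rewrite dotC dotZl dotC. Qed.

Lemma dot0l n (w : 'cV[R]_n) : dot 0 w = 0.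
Proof. by rewrite -(scale0r w) dotZl mul0r. Qed.

Lemma dot0r n (w : 'cV[R]_n) : dot w 0 = 0.
Proof. by rewrite dotC dot0l. Qed.

Lemma dotNr n (u w : 'cV[R]_n) : dot w (- u) = - dot w u.
Proof. by rewrite -scaleN1r dotZr mulN1r. Qed.

Lemma dotNl n (u w : 'cV[R]_n) : dot (- u) w = - dot u w.
Proof. by rewrite dotC dotNr dotC. Qed.

Lemma dotBr n (u v w : 'cV[R]_n) : dot w (u - v) = dot w u - dot w v.
Proof. by rewrite dotDr dotNr. Qed.

Lemma dotBl n (u v w : 'cV[R]_n) : dot (u - v) w = dot u w - dot v w.
Proof. by rewrite dotDl dotNl. Qed.

Lemma dot_sumr n (I : finType) (F : I -> 'cV[R]_n) w :
  dot w (\sum_i F i) = \sum_i dot w (F i).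
Proof. by apply: (big_morph (dot w)) => [u v|]; rewrite ?dotDr ?dot0r. Qed.

Lemma dot_mulmxr m n (A : 'M[R]_(m, n)) u v : dot u (A *m v) = dot (A^T *m u) v.
Proof.
rewrite /dot; under eq_bigr do rewrite mxE mulr_sumr.
rewrite exchange_big; apply: eq_bigr => j _.
by rewrite mxE mulr_suml; apply: eq_bigr => i _; rewrite mxE; ring.
Qed.

Lemma dotvv_ge0 n (v : 'cV[R]_n) : 0 <= dot v v.
Proof. by apply: sumr_ge0 => i _; rewrite -expr2 sqr_ge0. Qed.

Lemma dotvvB n (u v : 'cV[R]_n) :
  dot (u - v) (u - v) = dot u u - 2 * dot u v + dot v v.
Proof. by rewrite !dotBl !dotBr (dotC v u); ring. Qed.

Lemma sqr_enorm n (v : 'cV[R]_n) : enorm v ^+ 2 = dot v v.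
Proof.
rewrite sqr_sqrtr; first by apply: eq_bigr => i _; rewrite expr2.
by apply: sumr_ge0 => i _; exact: sqr_ge0.
Qed.

Lemma enorm_ge0 n (v : 'cV[R]_n) : 0 <= enorm v. Proof. exact: sqrtr_ge0. Qed.

Lemma dotvv_eq0 n (v : 'cV[R]_n) : dot v v = 0 -> v = 0.
Proof.
move=> /eqP; rewrite psumr_eq0; last by move=> *; rewrite -expr2 sqr_ge0.
move=> /allP H; apply/matrixP => i j; rewrite ord1 mxE.
by apply/eqP; have := H i; rewrite mem_index_enum mulf_eq0 orbb; exact.
Qed.

Lemma enorm_eq0 n (v : 'cV[R]_n) : enorm v = 0 -> v = 0.
Proof. by move=> v0; apply: dotvv_eq0; rewrite -sqr_enorm v0 expr0n. Qed.

Lemma enorm0 n : enorm (0 : 'cV[R]_n) = 0.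
Proof. by rewrite /enorm big1 ?sqrtr0// => i _; rewrite mxE expr0n. Qed.

Lemma enormZ n a (v : 'cV[R]_n) : enorm (a *: v) = `|a| * enorm v.
Proof.
apply/eqP; rewrite -(@eqrXn2 _ 2)// ?mulr_ge0 ?enorm_ge0//.
by rewrite exprMn !sqr_enorm dotZl dotZr real_normK ?num_real//; apply/eqP; ring.
Qed.

Lemma enormN n (v : 'cV[R]_n) : enorm (- v) = enorm v.
Proof. by rewrite -scaleN1r enormZ normrN normr1 mul1r. Qed.

Lemma normr_dot_le n (u v : 'cV[R]_n) : `|dot u v| <= enorm u * enorm v.
Proof.
rewrite -(@ler_pXn2r _ 2) ?nnegrE ?mulr_ge0 ?enorm_ge0//.
rewrite real_normK ?num_real// exprMn !sqr_enorm.
apply: (le_trans (sum_mul_sqr_le _ _ _)).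
by rewrite le_eqVlt; apply/orP; left; apply/eqP.
Qed.

Lemma dot_le n (u v : 'cV[R]_n) : dot u v <= enorm u * enorm v.
Proof. exact: le_trans (ler_norm _) (normr_dot_le _ _). Qed.

Lemma enormD_le n (u v : 'cV[R]_n) : enorm (u + v) <= enorm u + enorm v.
Proof.
rewrite -(@ler_pXn2r _ 2) ?nnegrE ?addr_ge0 ?enorm_ge0//.
rewrite sqr_enorm dotDl !dotDr -!sqr_enorm (dotC v u).
have := dot_le u v; nra.
Qed.

Lemma enormB_le n (u v : 'cV[R]_n) : enorm u - enorm v <= enorm (u - v).
Proof. by rewrite lerBlDr -{1}(subrK v u) enormD_le. Qed.

(** Cauchy-Schwarz against the all-ones vector. *)
Lemma sum_normr_le n (v : 'cV[R]_n) :
  \sum_i `|v i 0| <= Num.sqrt n%:R * enorm v.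
Proof.
have s0 : 0 <= \sum_i `|v i 0| by exact: sumr_ge0.
rewrite -(@ler_pXn2r _ 2) ?nnegrE ?mulr_ge0 ?enorm_ge0 ?sqrtr_ge0//.
rewrite exprMn sqr_sqrtr// sqr_enorm.
have := sum_mul_sqr_le xpredT (fun=> 1) (fun i => `|v i 0|).
under eq_bigr do rewrite mul1r.
rewrite expr1n sumr_const card_ord.
rewrite [X in _ <= _ * X -> _](eq_bigr (fun i => v i 0 * v i 0))// => i _.
by rewrite real_normK ?num_real// expr2.
Qed.

End Euclidean.

(** * Orthonormal eigenvectors of symmetric matrices *)

Section SymmetricEigenvectors.
Variable R : realType.

Lemma continuous_sumr (S : topologicalType) (I : Type) (r : seq I) (F : I -> S -> R) :
  (forall i, continuous (F i)) -> continuous (fun x => \sum_(i <- r) F i x).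
Proof. by move=> cF; apply: continuous_big => //; exact: add_continuous. Qed.

Lemma continuous_addr (S : topologicalType) (f g : S -> R) :
  continuous f -> continuous g -> continuous (fun x => f x + g x).
Proof. by move=> cf cg x; apply: cvgD; [exact: cf|exact: cg]. Qed.

Lemma continuous_mulr (S : topologicalType) (f g : S -> R) :
  continuous f -> continuous g -> continuous (fun x => f x * g x).
Proof. by move=> cf cg x; apply: cvgM; [exact: cf|exact: cg]. Qed.

Lemma continuous_sqr (S : topologicalType) (f : S -> R) :
  continuous f -> continuous (fun x => f x ^+ 2).
Proof. by move=> cf; apply: continuous_mulr. Qed.

Lemma continuous_dot (S : topologicalType) n (f g : S -> 'cV[R]_n) :
  (forall i, continuous (fun x => f x i 0)) ->
  (forall i, continuous (fun x => g x i 0)) ->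
  continuous (fun x => dot (f x) (g x)).
Proof.
move=> cf cg; by apply: continuous_sumr => i; apply: continuous_mulr.
Qed.

(** Fewer than [n] linear conditions have a nonzero common solution: the matrix with columns [s] has
    rank below [n], so its left kernel is nontrivial. *)
Lemma exists_orthogonal n (s : seq 'cV[R]_n) : (size s < n)%N ->
  exists2 v : 'cV[R]_n, dot v v = 1 & {in s, forall p, dot p v = 0}.
Proof.
move=> sn; pose B := \matrix_(i < n, j < size s) s`_j i 0.
have : kermx B != 0.
  by rewrite -mxrank_eq0 mxrank_ker -lt0n subn_gt0 (leq_ltn_trans (rank_leq_col B)).
move=> /rowV0Pn[v /sub_kermxP vB v0].
have w0 : 0 < enorm v^T.
  rewrite lt_neqAle enorm_ge0 andbT eq_sym; apply: contra v0 => /eqP/enorm_eq0.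
  by move=> /(congr1 trmx); rewrite trmxK trmx0 => ->.
exists ((enorm v^T)^-1 *: v^T).
  by rewrite dotZl dotZr -sqr_enorm expr2; field; rewrite gt_eqF.
move=> p ps; rewrite dotZr; have -> : dot p v^T = 0; last by rewrite mulr0.
have ip : (index p s < size s)%N by rewrite index_mem.
have /matrixP/(_ 0 (Ordinal ip)) := vB; rewrite !mxE => E.
rewrite -[RHS]E /dot; apply: eq_bigr => i _.
by rewrite !mxE /= nth_index// mulrC.
Qed.

(** Extreme value theorem on the unit sphere of the orthogonal complement of [s]. All constraints
    are packed into one continuous function [h], whose zero set is closed; a unit norm bounds every
    coordinate. Row vectors appear because [EVT_max_rV] is about them. *)
Lemma exists_rayleigh_max n (A : 'M[R]_n) (s : seq 'cV[R]_n) : (size s < n)%N ->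
  exists p : 'cV[R]_n, [/\ dot p p = 1, {in s, forall a, dot a p = 0} &
    forall v, dot v v = 1 -> {in s, forall a, dot a v = 0} ->
      dot v (A *m v) <= dot p (A *m p)].
Proof.
move=> /exists_orthogonal[v0 v01 v0s].
pose h (v : 'rV[R]_n) := \sum_(a <- s) dot a v^T ^+ 2 + (dot v^T v^T - 1) ^+ 2.
pose S := h @^-1` [set 0].
have hP v : h v = 0 <-> dot v^T v^T = 1 /\ {in s, forall a, dot a v^T = 0}.
  have t0 : 0 <= \sum_(a <- s) dot a v^T ^+ 2.
    by apply: sumr_ge0 => a _; exact: sqr_ge0.
  split => [/eqP|[v1 vs]]; last first.
    rewrite /h v1 subrr expr0n addr0 big_seq big1// => a /vs ->.
    by rewrite expr0n.
  rewrite /h paddr_eq0 ?sqr_ge0// sqrf_eq0 subr_eq0 => /andP[H /eqP ->].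
  split=> // a sa; move: H; rewrite psumr_eq0; last by move=> *; exact: sqr_ge0.
  by move=> /allP/(_ _ sa); rewrite sqrf_eq0 => /eqP.
have cT i : continuous (fun v : 'rV[R]_n => v^T i 0).
  by under eq_fun do rewrite mxE; exact: coord_continuous.
have cdot (a : 'cV[R]_n) : continuous (fun v : 'rV[R]_n => dot a v^T).
  by apply: continuous_dot => // i; exact: cst_continuous.
have ch : continuous h.
  apply: continuous_addr.
    by apply: continuous_sumr => a; exact: continuous_sqr.
  apply: continuous_sqr; apply: continuous_addr; last exact: cst_continuous.
  exact: (@continuous_dot _ n (fun v : 'rV[R]_n => v^T) (fun v => v^T) cT cT).
have S0 : S !=set0 by exists v0^T; apply/hP; rewrite trmxK.
have cS : compact S.
  apply: bounded_closed_compact; last first.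
    by apply: preimage_closed => //; exact: closed_eq.
  exists 1; split; first exact: num_real.
  move=> M M1 v /hP[v1 _]; have  [v0'|/mx_norm_neq0[i vi]] := eqVneq (`|v| : R) 0.
    by rewrite /= [leLHS]v0' (le_trans _ (ltW M1)).
  rewrite /= [leLHS]vi (le_trans _ (ltW M1))//.
  rewrite -(@ler_pXn2r _ 2) ?nnegrE// expr1n real_normK ?num_real// -v1 /dot.
  rewrite (bigD1 i.2)//= !mxE (ord1 i.1) expr2 lerDl.
  by apply: sumr_ge0 => j _; rewrite -expr2 sqr_ge0.
have cf : {within S, continuous (fun v : 'rV[R]_n => dot v^T (A *m v^T))}.
  apply: continuous_subspaceT; apply: continuous_dot => // i.
  under eq_fun do rewrite mxE.
  apply: continuous_sumr => j; apply: continuous_mulr; last exact: cT.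
  exact: cst_continuous.
have [c] := EVT_max_rV S0 cS cf.
rewrite inE => /hP[c1 cs] cmax; exists c^T; split=> // v v1 vs.
by have := cmax v^T; rewrite trmxK; apply; rewrite inE; apply/hP; rewrite trmxK.
Qed.

(* The maximizer of the Rayleigh quotient on the orthogonal complement of
   eigenvectors found so far is an eigenvector: the nonnegative form
   [l |v|^2 - v^T A v] vanishes at [p], hence so does its polar form there. *)
Lemma exists_orthonormal_eigenvectors n (A : 'M[R]_n) (k : nat) :
  A^T = A -> (k <= n)%N ->
  exists s : seq 'cV[R]_n, [/\ size s = k, pairwise (fun u v => dot u v == 0) s,
    {in s, forall p, dot p p = 1} &
    {in s, forall p, exists l, A *m p = l *: p}].
Proof.
move=> Asym; elim: k => [|k IH] kn; first by exists [::].
have [s [sk ps s1 sA]] := IH (ltnW kn).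
have [|p [p1 psx pmax]] := @exists_rayleigh_max n A s; first by rewrite sk.
have dotA u v : dot u (A *m v) = dot (A *m u) v by rewrite dot_mulmxr Asym.
exists (p :: s); split; first by rewrite /= sk.
- rewrite pairwise_cons ps andbT; apply/allP => a sa.
  by rewrite dotC psx.
- by move=> q; rewrite inE => /predU1P[->//|]; exact: s1.
move=> q; rewrite inE => /predU1P[->{q}|]; last exact: sA.
set l := dot p (A *m p) in pmax; exists l.
(* Homogeneity carries maximality from unit vectors to all vectors of the complement. *)
have form v : {in s, forall a, dot a v = 0} -> dot v (A *m v) <= l * dot v v.
  move=> vs; have [->|v0] := eqVneq v 0; first by rewrite mulmx0 !dot0r mulr0.
  have e0 : 0 < enorm v.
    by rewrite lt_neqAle enorm_ge0 andbT eq_sym; apply: contra v0 => /eqP/enorm_eq0->.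
  have := pmax ((enorm v)^-1 *: v).
  rewrite -scalemxAr !dotZl !dotZr -!sqr_enorm => /(_ _ _)/wrap[||].
  - by field; rewrite gt_eqF.
  - by move=> a /vs av; rewrite dotZr av mulr0.
  move=> H; rewrite -(ler_pM2l (_ : 0 < (enorm v)^-1 ^+ 2)) ?exprn_gt0 ?invr_gt0//.
  by rewrite expr2 -!mulrA; apply: (le_trans H); rewrite le_eqVlt; apply/orP; left;
    apply/eqP; field; rewrite gt_eqF.
(* The residual of the eigenvector equation; the rest shows that it is zero. *)
have [h hE] : exists h, h = A *m p - l *: p by eexists.
have hs : {in s, forall a, dot a h = 0}.
  (* By symmetry [A] moves onto [a], which is an eigenvector, so the complement of [s] is stable
     under [A]. *)
  move=> a sa; rewrite hE dotBr dotZr psx// mulr0 subr0 dotA.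
  by have [m ->] := sA a sa; rewrite dotZl psx// mulr0.
(* The form is evaluated at [p + t *: h]: the constant term vanishes since the form is zero at [p],
   and the linear term is [- 2 * t * dot h h]. *)
have key t : 0 <= t ^+ 2 * (l * dot h h - dot h (A *m h)) - 2 * t * dot h h.
  have := form (p + t *: h); rewrite mulmxDr -scalemxAr => /(_ _)/wrap[|].
    by move=> a sa; rewrite dotDr dotZr psx// hs// mulr0 addr0.
  have hh : dot h h = dot h (A *m p) - l * dot h p.
    by rewrite {2}hE dotBr dotZr.
  rewrite !dotDl !dotDr !dotZl !dotZr p1 -/l [dot p (A *m h)]dotA [dot (A *m p) h]dotC.
  rewrite (dotC p h).
  have -> : dot h (A *m p) = dot h h + l * dot h p by rewrite hh subrK.
  by move: (dot h h) (dot h p) (dot h (A *m h)) => x y z H; lra.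
have h0 : dot h h = 0.
  move: key (dotvv_ge0 h); move: (dot h h) => x; move: (l * x - _) => C key.
  rewrite le_eqVlt => /predU1P[->//|x0]; exfalso.
  have C1 : 0 < `|C| + 1 by rewrite ltr_wpDl.
  (* Small enough that [t ^+ 2 * C <= t * x]; then [key] would give [0 <= - (t * x)]. *)
  pose t := x / (`|C| + 1).
  have t0 : 0 < t by rewrite divr_gt0.
  have tx : t * (`|C| + 1) = x by rewrite divfK// gt_eqF.
  have := key t; have := ler_norm C.
  have : t * `|C| <= x by rewrite -tx ler_pM2l// lerDl.
  move=> H1 H2 H3; have : t ^+ 2 * C <= t * x.
    by rewrite expr2 -mulrA ler_pM2l// (le_trans _ H1)// ler_pM2l.
  by nra.
by apply/eqP; rewrite -subr_eq0 -hE; apply/eqP/dotvv_eq0.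
Qed.

End SymmetricEigenvectors.

(** * Orthogonal vectors attached to a Gram matrix *)

Section Gram.
Variable R : realType.

(** The matrix [Q] with rows [s] satisfies [Q *m Q^T = 1]; being square, it also satisfies
    [Q^T *m Q = 1], hence preserves norms. *)
Lemma parseval n (s : seq 'cV[R]_n) : size s = n ->
  pairwise (fun u v => dot u v == 0) s -> {in s, forall p, dot p p = 1} ->
  forall v, \sum_(p <- s) dot p v ^+ 2 = dot v v.
Proof.
move=> sn ps s1 v; pose Q : 'M[R]_n := \matrix_(i, j) s`_i j 0.
have QQ : Q *m Q^T = 1%:M.
  apply/matrixP => i j; rewrite !mxE.
  transitivity (dot s`_i s`_j); first by apply: eq_bigr => k _; rewrite !mxE.
  have si (l : 'I_n) : (l < size s)%N by rewrite sn.
  case: (ltngtP i j) => [ij|ji|/val_inj ->].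
  - have /eqP -> := (pairwiseP 0 ps) i j (si i) (si j) ij.
    by case: eqP ij => // ->; rewrite ltnn.
  - have /eqP := (pairwiseP 0 ps) j i (si j) (si i) ji.
    by rewrite dotC => ->; case: eqP ji => // ->; rewrite ltnn.
  - by rewrite eqxx s1// mem_nth.
have -> : dot v v = dot (Q *m v) (Q *m v).
  by rewrite dot_mulmxr mulmxA (mulmx1C QQ) mul1mx.
rewrite (big_nth 0) sn big_mkord; apply: eq_bigr => i _.
by rewrite expr2; congr (_ * _); rewrite mxE; apply: eq_bigr => j _; rewrite !mxE.
Qed.

Lemma enorm_mulmx_le_spectral_norm n (A : 'M[R]_n) (v : 'cV[R]_n) :
  enorm v <= 1 -> enorm (A *m v) <= spectral_norm A.
Proof.
move=> v1; apply: sup_upper_bound; last by exists v.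
split; first by exists (enorm (A *m v)), v.
(* A supremum dominates its set only when the set is bounded; here the Frobenius norm is a bound, by
   Cauchy-Schwarz in each row. *)
exists (Num.sqrt (\sum_i \sum_j A i j ^+ 2)) => _ [u /= u1 <-].
rewrite ler_wsqrtr//; apply: ler_sum => i _; rewrite mxE.
apply: (le_trans (sum_mul_sqr_le _ _ _)).
rewrite ler_piMr//; first by apply: sumr_ge0 => j _; exact: sqr_ge0.
have -> : \sum_j u j 0 ^+ 2 = enorm u ^+ 2.
  by rewrite sqr_enorm; apply: eq_bigr => j _; rewrite expr2.
by rewrite expr_le1// enorm_ge0.
Qed.

(** Take [B *m p] for [p] in an orthonormal eigenbasis of [A]. Since [dot (B *m p) (B *m q) = N *
    dot p (A *m q)], these vectors are orthogonal, with squared norms [N] times the eigenvalues.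
    Parseval applied to [B^T *m w] gives the last identity. *)
Lemma gram_orthogonalization N k (B : 'M[R]_(N, k)) : (0 < N)%N ->
  let A := N%:R^-1 *: (B^T *m B) in
  exists s : seq 'cV[R]_N, [/\ size s = k,
    pairwise (fun u v => dot u v == 0) s,
    {in s, forall a, dot a a <= N%:R * spectral_norm A},
    \sum_(a <- s) dot a a = N%:R * \tr A &
    forall w, \sum_(a <- s) dot a w ^+ 2 = dot (B^T *m w) (B^T *m w)].
Proof.
move=> N0 A; have NR : 0 < N%:R :> R by rewrite ltr0n.
have NA : B^T *m B = N%:R *: A by rewrite scalerA divff ?scale1r// gt_eqF.
have Asym : A^T = A by rewrite /A linearZ/= trmx_mul trmxK.
have [s [sk ps s1 sA]] := exists_orthonormal_eigenvectors Asym (leqnn k).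
have dB p q : dot (B *m p) (B *m q) = N%:R * dot p (A *m q).
  by rewrite dot_mulmxr mulmxA NA dotC -scalemxAl dotZr; congr (_ * _);
    rewrite dot_mulmxr Asym dotC.
exists [seq B *m p | p <- s]; split.
- by rewrite size_map.
- rewrite pairwise_map; apply: (sub_in_pairwise (P := mem s)) ps; last exact/allP.
  move=> p q ps qs /= /eqP pq.
  by rewrite dB; have [l ->] := sA q qs; rewrite dotZr pq !mulr0.
- move=> _ /mapP[p ps0 ->]; rewrite dB ler_pM2l//.
  have p1 : enorm p = 1 by rewrite /enorm -[RHS]sqrtr1 -(s1 _ ps0); congr Num.sqrt;
    apply: eq_bigr => i _; rewrite expr2.
  apply: (le_trans (dot_le _ _)); rewrite p1 mul1r.
  by apply: enorm_mulmx_le_spectral_norm; rewrite p1.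
- rewrite big_map -mxtraceZ -NA /mxtrace.
  (* Parseval on each row of [B] identifies the sum with the squared Frobenius norm of [B], which is
     the trace of [B^T *m B]. *)
  transitivity (\sum_(p <- s) \sum_i dot p (row i B)^T ^+ 2).
    apply: eq_bigr => p _; apply: eq_bigr => i _; rewrite -expr2; congr (_ ^+ 2).
    by rewrite mxE; apply: eq_bigr => j _; rewrite !mxE mulrC.
  rewrite exchange_big/=; under eq_bigr do rewrite (parseval sk ps s1).
  under [RHS]eq_bigr do rewrite mxE.
  by rewrite exchange_big; do 2!(apply: eq_bigr => ? _); rewrite !mxE.
- move=> w; rewrite big_map -(parseval sk ps s1); apply: eq_bigr => p _.
  by rewrite dotC dot_mulmxr dotC.
Qed.

End Gram.

(** * Gaussian quadratic forms *)

(** From indicators to simple functions by linearity, then to nonnegative functions by monotone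
    convergence. The weight [Y] allows one factor of a product to be treated while the others are
    carried along. *)
Lemma integral_density_transfer (R : realType) (d1 d2 : measure_display)
    (T1 : measurableType d1) (T2 : measurableType d2)
    (m1 : {measure set T1 -> \bar R}) (m2 : {measure set T2 -> \bar R})
    (W : T1 -> T2) (Y : T1 -> R) (g f : T2 -> R) :
  measurable_fun setT W -> measurable_fun setT Y -> measurable_fun setT g ->
  (forall w, 0 <= Y w) -> (forall x, 0 <= g x) ->
  (forall B, measurable B ->
     (\int[m1]_w (Y w * \1_B (W w))%:E = \int[m2]_x (g x * \1_B x)%:E)%E) ->
  measurable_fun setT f -> (forall x, 0 <= f x) ->
  (\int[m1]_w (Y w * f (W w))%:E = \int[m2]_x (g x * f x)%:E)%E.
Proof.
move=> mW mY mg Y0 g0 H mf f0.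
have /measurable_EFinP mfE := mf.
pose h := nnsfun_approx measurableT mfE.
have hlim x : EFin \o h^~ x @ \oo --> (f x)%:E.
  by apply: (cvg_nnsfun_approx measurableT mfE) => //= t _; rewrite lee_fin.
have mh n : measurable_fun [set: T2] (h n) by [].
have mYh n : measurable_fun [set: T1] (fun w => (Y w * h n (W w))%:E).
  by apply/measurable_EFinP/measurable_funM => //; exact: measurableT_comp.
have mgh n : measurable_fun [set: T2] (fun x => (g x * h n x)%:E).
  by apply/measurable_EFinP/measurable_funM.
have H1 n : (\int[m1]_w (Y w * h n (W w))%:E = \int[m2]_x (g x * h n x)%:E)%E.
  have E1 (c : R) z : ((c * h n z)%:E
      = \sum_(r \in range (h n)) (r * (c * \1_(h n @^-1` [set r]) z))%:E)%E.
    rewrite fsumEFin//; congr EFin; rewrite fimfunE mulr_fsumr//.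
    by apply: eq_fsbigr => r _; rewrite mulrCA.
  under eq_integral do rewrite E1.
  under [RHS]eq_integral do rewrite E1.
  have mB r : measurable (h n @^-1` [set r]) by exact: measurable_sfunP.
  have m1r r : measurable_fun [set: T1]
      (fun w => (Y w * \1_(h n @^-1` [set r]) (W w))%:E).
    apply/measurable_EFinP/measurable_funM => //.
    by apply: measurableT_comp => //; exact: measurable_indic.
  have m2r r : measurable_fun [set: T2]
      (fun x => (g x * \1_(h n @^-1` [set r]) x)%:E).
    by apply/measurable_EFinP/measurable_funM.
  (* [r] may be negative here: the product is still nonnegative, because on a nonempty level set [r]
     is a value of [h n]. *)
  have pos (c r : R) z : 0 <= c -> (0 <= (r * (c * \1_(h n @^-1` [set r]) z))%:E)%E.
    move=> c0; rewrite lee_fin mulrCA mulr_ge0// indicE.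
    have [zr|] := boolP (z \in _); last by rewrite mulr0.
    by rewrite mulr1; move: zr; rewrite inE/= => <-.
  rewrite !ge0_integral_fsum//.
  - apply: eq_fsbigr => r; rewrite inE => -[z _ zr].
    have r0 : (0 <= r%:E)%E by rewrite lee_fin -zr.
    under eq_integral do rewrite EFinM.
    under [RHS]eq_integral do rewrite EFinM.
    rewrite !ge0_integralZl// ?H//.
    + by move=> x _; rewrite lee_fin mulr_ge0.
    + by move=> x _; rewrite lee_fin mulr_ge0.
  - by move=> r; apply/measurable_EFinP/measurable_funM => //; exact/measurable_EFinP/m2r.
  - by move=> r x _; exact: pos.
  - move=> r; apply/measurable_EFinP/measurable_funM => //; exact/measurable_EFinP/m1r.
  - by move=> r x _; exact: pos.
transitivity (limn (fun n => (\int[m1]_w (Y w * h n (W w))%:E)%E)).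
  rewrite -monotone_convergence//=.
  - apply: eq_integral => w _; apply/esym/cvg_lim => //.
    under eq_fun do rewrite EFinM.
    by rewrite EFinM; apply: cvgeZl => //; exact: hlim.
  - by move=> n x _; rewrite lee_fin mulr_ge0.
  - move=> x _ a b ab; rewrite lee_fin ler_wpM2l//.
    exact/lefP/nd_nnsfun_approx.
under eq_fun do rewrite H1.
rewrite -monotone_convergence//=.
- apply: eq_integral => w _; apply/cvg_lim => //.
  under eq_fun do rewrite EFinM.
  by rewrite EFinM; apply: cvgeZl => //; exact: hlim.
- by move=> n x _; rewrite lee_fin mulr_ge0.
- move=> x _ a b ab; rewrite lee_fin ler_wpM2l//.
  exact/lefP/nd_nnsfun_approx.
Qed.

(** Independence is the product formula for indicators only. The claim [gen] interpolates: factors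
    with index outside [s] must be indicators, and [s] grows to all of [I]. *)
Lemma independent_integral_prod (d : measure_display) (T : measurableType d)
    (R : realType) (P : probability T R) (I : finType) (W : I -> {RV P >-> R})
    (p : I -> R -> R) :
  mutually_independent W ->
  (forall i, measurable_fun setT (p i)) -> (forall i x, 0 <= p i x) ->
  (forall i B, measurable B -> P (W i @^-1` B) =
     \int[lebesgue_measure]_x (p i x * \1_B x)%:E)%E ->
  forall (f : I -> R -> R) (c : I -> R),
  (forall i, measurable_fun setT (f i)) -> (forall i x, 0 <= f i x) ->
  (forall i, \int[lebesgue_measure]_x (p i x * f i x)%:E = (c i)%:E)%E ->
  (\int[P]_w (\prod_i f i (W i w))%:E = (\prod_i c i)%:E)%E.
Proof.
move=> indW mp p0 Hp.
suff gen (s : seq I) (f : I -> R -> R) (c : I -> R) :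
    (forall i, measurable_fun setT (f i)) -> (forall i x, 0 <= f i x) ->
    (forall i, \int[lebesgue_measure]_x (p i x * f i x)%:E = (c i)%:E)%E ->
    (forall i, i \notin s -> exists2 B, measurable B & f i = \1_B) ->
    (\int[P]_w (\prod_i f i (W i w))%:E = (\prod_i c i)%:E)%E.
  move=> f c mf f0 fc; apply: (gen (enum I)) => // i.
  by rewrite mem_enum.
(* The indicators are replaced by general factors one index at a time. *)
elim: s f c => [|j s IH] f c mf f0 fc fB.
  have /choice[B HB] : forall i, exists B, measurable B /\ f i = \1_B.
    by move=> i; have [B mB fiB] := fB i isT; exists B.
  have mB i : measurable (B i) by have [] := HB i.
  have := indW [set: I]%SET B mB.
  have -> : [set w | forall i, i \in [set: I]%SET -> B i (W i w)]
      = \bigcap_(i in [set: I]) (W i @^-1` B i).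
    apply/seteqP; split => w /= H i; first by move=> _; apply: H; rewrite inE.
    by move=> _; exact: H.
  set S := \bigcap_(i in _) _ => PS.
  have mS : measurable S.
    apply: fin_bigcap_measurable => //.
    by move=> i _; exact: measurable_sfunP.
  transitivity (P S).
    rewrite -[in RHS](setIT S) -integral_indic//; apply: eq_integral => w _.
    congr EFin; rewrite indicE; case: (boolP (w \in S)) => wS.
      rewrite big1// => i _; have [_ ->] := HB i; rewrite indicE mem_set//.
      by move: wS; rewrite inE => /(_ i Logic.I).
    have [i iB] : exists i, ~ B i (W i w).
      apply/existsNP => H; move/negP: wS; apply; rewrite inE => i _.
      exact: H.
    rewrite (bigD1 i)//=; have [_ ->] := HB i.
    by rewrite indicE memNset// mul0r.
  rewrite PS -prodEFin; apply: eq_big => [i|i _]; first by rewrite inE.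
  by rewrite Hp// -fc; have [_ ->] := HB i.
have c0 i : 0 <= c i.
  rewrite -lee_fin -fc; apply: integral_ge0 => x _; rewrite lee_fin.
  by rewrite mulr_ge0.
pose C := \prod_(i | i != j) c i.
have C0 : 0 <= C by exact: prodr_ge0.
have mprod (Q : pred I) : measurable_fun [set: T] (fun w => \prod_(i | Q i) f i (W i w)).
  under eq_fun do rewrite -big_filter.
  by apply: measurable_prod => i _; apply: measurableT_comp.
under eq_integral => w _.
  rewrite (bigD1 j)//= mulrC. over.
(* The product of the other factors plays the weight [Y], so the factor at [j] need only be tested
   on indicators. *)
rewrite (@integral_density_transfer R _ _ T (measurableTypeR R) P lebesgue_measure (W j) _
  (fun x => C * p j x))//; last exact: mf.
- under eq_integral do rewrite -mulrA EFinM.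
  rewrite ge0_integralZl//.
  + by rewrite fc (bigD1 j)//= -/C mulrC EFinM.
  + by apply/measurable_EFinP/measurable_funM; [exact: mp|exact: mf].
  + by move=> x _; rewrite lee_fin mulr_ge0.
- exact: (measurable_funPT (W j)).
- by apply: measurable_funM => //; exact: mp.
- by move=> w; apply: prodr_ge0.
- by move=> x; rewrite mulr_ge0.
move=> B mB.
(* With an indicator at [j], the only possibly general factors have index in [s], and the induction
   hypothesis applies. *)
pose f' i := if i == j then \1_B else f i.
pose c' i := if i == j then fine (P (W j @^-1` B)) else c i.
transitivity (\int[P]_w (\prod_i f' i (W i w))%:E)%E.
  apply: eq_integral => w _; congr EFin; rewrite [RHS](bigD1 j)//= mulrC.
  rewrite {1}/f' eqxx; congr (_ * _); apply: eq_bigr => i /negPf ij.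
  by rewrite /f' ij.
have mWB : measurable (W j @^-1` B) by exact: measurable_sfunP.
rewrite (IH f' c').
- rewrite (bigD1 j)//= {1}/c' eqxx.
  rewrite (eq_bigr c); last by move=> i /negPf ij; rewrite /c' ij.
  rewrite -/C mulrC EFinM fineK; last exact: fin_num_measure.
  rewrite Hp// -ge0_integralZl//.
  + by apply: eq_integral => x _; rewrite -EFinM mulrA.
  + by apply/measurable_EFinP/measurable_funM => //; exact: mp.
  + by move=> x _; rewrite lee_fin mulr_ge0// indicE.
- by move=> i; rewrite /f'; case: ifP.
- by move=> i x; rewrite /f'; case: ifP => // _; rewrite indicE.
- move=> i; rewrite /f' /c'; case: eqP => [->|//].
  by rewrite -Hp// fineK//; exact: fin_num_measure.
- move=> i; rewrite /f'; case: eqP => [->|/eqP ij] si; first by exists B.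
  by apply: fB; rewrite inE negb_or ij.
Qed.

(** Completing the square: the exponential tilt shifts the mean to [s ^+ 2 * b], up to the stated
    constant. *)
Lemma integral_normal_pdf_expR (R : realType) (s b : R) : s != 0 ->
  (\int[lebesgue_measure]_x (normal_pdf 0 s x * expR (b * x))%:E
    = (expR (s ^+ 2 * b ^+ 2 / 2))%:E)%E.
Proof.
move=> s0.
transitivity (\int[lebesgue_measure]_x
   ((expR (s ^+ 2 * b ^+ 2 / 2))%:E * (normal_pdf (s ^+ 2 * b) s x)%:E))%E.
  apply: eq_integral => x _; rewrite -EFinM; congr EFin.
  rewrite !normal_pdfE// /normal_fun mulrCA -!mulrA -!expRD; congr (_ * expR _).
  by rewrite -[s ^+ 2 *+ 2]mulr_natr; field.
rewrite ge0_integralZl//.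
- by rewrite integral_normal_pdf mule1.
- by apply/measurable_EFinP; exact: measurable_normal_pdf.
- by move=> x _; rewrite lee_fin normal_pdf_ge0.
Qed.

(** The factor changes the variance from 1 to [(1 - c)^-1]; only the change of normalizing constant
    remains. *)
Lemma integral_normal_pdf_expR_sqr (R : realType) (c : R) : c < 1 ->
  (\int[lebesgue_measure]_x (normal_pdf 0 1 x * expR (c * x ^+ 2 / 2))%:E
    = ((Num.sqrt (1 - c))^-1)%:E)%E.
Proof.
move=> c1; set s := (Num.sqrt (1 - c))^-1.
have r0 : 0 < Num.sqrt (1 - c) by rewrite sqrtr_gt0 subr_gt0.
have s0 : 0 < s by rewrite invr_gt0.
have s2 : s ^+ 2 = (1 - c)^-1.
  by rewrite exprVn sqr_sqrtr// subr_ge0 ltW.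
transitivity (\int[lebesgue_measure]_x (s%:E * (normal_pdf 0 s x)%:E))%E.
  apply: eq_integral => x _; rewrite -EFinM; congr EFin.
  rewrite !normal_pdfE ?oner_eq0 ?gt_eqF// /normal_fun [RHS]mulrA.
  have -> : s * normal_peak s = normal_peak 1.
    rewrite /normal_peak -!mulrnAr sqrtrM ?sqr_ge0// sqrtr_sqr gtr0_norm//.
    by rewrite expr1n mul1r invfM mulrA divff ?mul1r// gt_eqF.
  rewrite -[LHS]mulrA -expRD; congr (_ * expR _).
  rewrite s2 -[X in _ / X + _]mulr_natr -[X in _ = _ / X]mulr_natr.
  by field; rewrite subr_eq0 gt_eqF.
rewrite ge0_integralZl//.
- by rewrite integral_normal_pdf mule1.
- by apply/measurable_EFinP; exact: measurable_normal_pdf.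
- by move=> x _; rewrite lee_fin normal_pdf_ge0.
- by rewrite lee_fin ltW.
Qed.

Section GaussianNoise.
Variables (R : realType) (d : measure_display) (T : measurableType d).
Variables (P : probability T R) (N : nat) (sigma : R) (W : 'I_N -> {RV P >-> R}).
Hypotheses (sigma_gt0 : 0 < sigma) (gaussW : iid_centered_normal sigma W).

Let noise w : 'cV[R]_N := \col_(i < N) W i w.

Lemma measurable_dot_noise (b : 'cV[R]_N) :
  measurable_fun setT (fun w => dot b (noise w)).
Proof.
rewrite /dot; apply: measurable_sum => i; under eq_fun do rewrite mxE.
by apply: measurable_funM => //; exact: (measurable_funPT (W i)).
Qed.

Lemma integral_expR_dot_noise (b : 'cV[R]_N) :
  (\int[P]_w (expR (dot b (noise w)))%:E
    = (expR (sigma ^+ 2 * dot b b / 2))%:E)%E.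
Proof.
have [indW lawW] := gaussW.
have s0 : sigma != 0 by rewrite gt_eqF.
under eq_integral do rewrite /dot expR_sum.
rewrite (eq_integral (fun w => (\prod_(i < N) expR (b i 0 * W i w))%:E)); last first.
  by move=> w _; congr EFin; apply: eq_bigr => i _; rewrite mxE.
rewrite (@independent_integral_prod _ _ _ P _ W (fun=> normal_pdf 0 sigma) indW _ _ _
  (fun i x => expR (b i 0 * x)) (fun i => expR (sigma ^+ 2 * b i 0 ^+ 2 / 2))).
- rewrite -expR_sum; congr (expR _)%:E.
  rewrite /dot mulr_sumr mulr_suml; apply: eq_bigr => i _; ring.
- by move=> i; exact: measurable_normal_pdf.
- by move=> i x; exact: normal_pdf_ge0.
- move=> i B mB; rewrite -[LHS]/(distribution P (W i) B) lawW//.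
  rewrite /normal_prob integral_mkcond; apply: eq_integral => x _.
  by rewrite patchE indicE; case: ifPn => _; rewrite ?mulr1 ?mulr0.
- by move=> i; apply: measurableT_comp => //; exact: measurable_funM.
- by move=> i x; rewrite expR_ge0.
- by move=> i; exact: integral_normal_pdf_expR.
Qed.

End GaussianNoise.

Section GaussianQuadratic.
Variables (R : realType) (d : measure_display) (T : measurableType d).
Variables (P : probability T R) (N : nat) (sigma : R) (W : 'I_N -> {RV P >-> R}).
Hypotheses (sigma_gt0 : 0 < sigma) (gaussW : iid_centered_normal sigma W).

Let noise w : 'cV[R]_N := \col_(i < N) W i w.

(** The linear term [b] is there for the induction: linearizing the square of [a] replaces [b] by
    [b + x *: a], which stays orthogonal to the remaining vectors because they are orthogonal to
    [a]. *)
Lemma integral_expR_quadratic_noise (A : seq 'cV[R]_N) (b : 'cV[R]_N) :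
  pairwise (fun u v => dot u v == 0) A ->
  {in A, forall a, dot b a = 0} ->
  {in A, forall a, sigma ^+ 2 * dot a a < 1} ->
  (\int[P]_w (expR (\sum_(a <- A) dot a (noise w) ^+ 2 / 2 + dot b (noise w)))%:E
    = (\prod_(a <- A) (Num.sqrt (1 - sigma ^+ 2 * dot a a))^-1
        * expR (sigma ^+ 2 * dot b b / 2))%:E)%E.
Proof.
elim: A b => [|a A IH] b.
  move=> _ _ _; rewrite big_nil mul1r -(integral_expR_dot_noise sigma_gt0 gaussW).
  by apply: eq_integral => w _; rewrite big_nil add0r.
rewrite pairwise_cons => /andP[/allP aA pA] bA A1.
pose S w := \sum_(a' <- A) dot a' (noise w) ^+ 2 / 2 + dot b (noise w).
have mS : measurable_fun [set: T] S.
  apply: measurable_funD; last exact: measurable_dot_noise.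
  apply: measurable_sum => a'; apply: measurable_funM => //.
  by apply: measurable_funX; exact: measurable_dot_noise.
pose f (z : T * measurableTypeR R) : \bar R :=
  (normal_pdf 0 1 z.2 * expR (S z.1 + z.2 * dot a (noise z.1)))%:E.
have mf : measurable_fun [set: T * measurableTypeR R] f.
  apply/measurable_EFinP/measurable_funM.
    apply: (measurableT_comp (measurable_normal_pdf 0 1)).
    exact: measurable_snd.
  apply: measurableT_comp => //; apply: measurable_funD.
    by apply: (measurableT_comp mS); exact: measurable_fst.
  apply: measurable_funM; first exact: measurable_snd.
  by apply: (measurableT_comp (measurable_dot_noise W a)); exact: measurable_fst.
have f0 z : (0 <= f z)%E.
  by rewrite lee_fin mulr_ge0 ?normal_pdf_ge0 ?expR_ge0.
transitivity (\int[P]_w \int[lebesgue_measure]_x f (w, x))%E.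
  apply: eq_integral => w _.
  rewrite big_cons -addrA -/(S w) addrC expRD EFinM.
  have := integral_normal_pdf_expR (dot a (noise w)) (oner_neq0 R).
  rewrite expr1n mul1r => <-; rewrite -ge0_integralZl//.
  - apply: eq_integral => x _; rewrite -EFinM; congr EFin.
    by rewrite mulrCA -expRD (mulrC x).
  - apply/measurable_EFinP/measurable_funM; first exact: measurable_normal_pdf.
    by apply: measurableT_comp => //; exact: measurable_funM.
  - by move=> x _; rewrite lee_fin mulr_ge0 ?normal_pdf_ge0 ?expR_ge0.
rewrite fubini_tonelli//.
set p := \prod_(a' <- A) (Num.sqrt (1 - sigma ^+ 2 * dot a' a'))^-1.
set e := expR (sigma ^+ 2 * dot b b / 2).
have pe0 : 0 <= p * e.
  by rewrite mulr_ge0 ?expR_ge0//; apply: prodr_ge0 => *; rewrite invr_ge0 sqrtr_ge0.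
transitivity (\int[lebesgue_measure]_x ((p * e)%:E *
    (normal_pdf 0 1 x * expR ((sigma ^+ 2 * dot a a) * x ^+ 2 / 2))%:E))%E.
  apply: eq_integral => x _.
  transitivity ((normal_pdf 0 1 x)%:E * \int[P]_w (expR (\sum_(a' <- A)
      dot a' (noise w) ^+ 2 / 2 + dot (b + x *: a) (noise w)))%:E)%E.
    rewrite -ge0_integralZl//.
    - apply: eq_integral => w _; rewrite -EFinM; congr (_ * expR _)%:E.
      by rewrite dotDl dotZl addrA.
    - apply/measurable_EFinP/measurableT_comp => //; apply: measurable_funD.
        apply: measurable_sum => a'; apply: measurable_funM => //.
        by apply: measurable_funX; exact: measurable_dot_noise.
      exact: measurable_dot_noise.
    - by rewrite lee_fin normal_pdf_ge0.
  rewrite IH//.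
  - rewrite -!EFinM; congr EFin; rewrite -/p mulrCA -!mulrA; congr (_ * _).
    rewrite [RHS]mulrCA /e -expRD; congr (_ * expR _).
    (* Without a cross term, [x] enters only through [x ^+ 2], so the outer integral is that of
       [integral_normal_pdf_expR_sqr]. *)
    have ba : dot b a = 0 by rewrite bA// mem_head.
    by rewrite dotDl !dotDr !dotZl !dotZr (dotC a b) ba; field.
  - move=> a' a'A; rewrite dotDl dotZl bA ?inE ?a'A ?orbT// add0r.
    by rewrite (eqP (aA _ a'A)) mulr0.
  - by move=> a' a'A; apply: A1; rewrite inE a'A orbT.
rewrite ge0_integralZl//.
- rewrite integral_normal_pdf_expR_sqr; last by apply: A1; rewrite mem_head.
  by rewrite -EFinM big_cons -/p mulrC mulrA.
- apply/measurable_EFinP/measurable_funM; first exact: measurable_normal_pdf.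
  apply: measurableT_comp => //; apply: measurable_funM => //.
  by apply: measurable_funM => //; exact: measurable_funX.
- by move=> x _; rewrite lee_fin mulr_ge0 ?normal_pdf_ge0 ?expR_ge0.
Qed.

End GaussianQuadratic.

(** * Laurent-Massart tail bound for weighted chi-square sums *)

Section ChiSquareTail.
Variable R : realType.

(** The partial sums of the exponential series increase for nonnegative [x]. *)
Lemma expR_ge_quadratic (x : R) : 0 <= x -> 1 + x + x ^+ 2 / 2 <= expR x.
Proof.
move=> x0; have := @nondecreasing_cvgn_le _ (series (exp_coeff x)).
move=> /(_ _ (is_cvg_series_exp_coeff x) 3); rewrite -/(expR x).
rewrite /series/= !big_nat_recr//= big_geq// add0r /exp_coeff/=.
rewrite expr0 expr1 !divr1; apply.
by apply: nondecreasing_series => n _ _; exact: exp_coeff_ge0.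
Qed.

Lemma rsqrt_le_expR (u : R) : 0 <= u -> u < 1 ->
  (Num.sqrt (1 - u))^-1 <= expR (u / 2 + u ^+ 2 / (4 * (1 - u))).
Proof.
move=> u0 u1; have v0 : 0 < 1 - u by rewrite subr_gt0.
rewrite -(@ler_pXn2r _ 2) ?nnegrE ?invr_ge0 ?sqrtr_ge0 ?expR_ge0//.
rewrite exprVn sqr_sqrtr ?(ltW v0)// -expRM_natl.
have -> : 2 * (u / 2 + u ^+ 2 / (4 * (1 - u))) = (u * (1 - u / 2)) / (1 - u).
  by field; rewrite gt_eqF.
(* [y = (a - a^-1) / 2] for [a = (1 - u)^-1], so the claim is [ln a <= y]. *)
set y := _ / _; have y0 : 0 <= y.
  by rewrite divr_ge0 ?(ltW v0)// mulr_ge0//; lra.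
apply: le_trans (expR_ge_quadratic y0).
rewrite -subr_ge0; have -> : 1 + y + y ^+ 2 / 2 - (1 - u)^-1
    = u ^+ 4 / (8 * (1 - u) ^+ 2) by rewrite /y; field; rewrite gt_eqF.
by rewrite divr_ge0 ?mulr_ge0 ?exprn_ge0// (ltW v0).
Qed.

Variables (d : measure_display) (T : measurableType d) (P : probability T R).
Variables (N : nat) (sigma : R) (W : 'I_N -> {RV P >-> R}).
Hypotheses (N_gt0 : (0 < N)%N) (sigma_gt0 : 0 < sigma).
Hypothesis gaussW : iid_centered_normal sigma W.

Let noise w : 'cV[R]_N := \col_(i < N) W i w.

Lemma measurable_sqr_mulmx_noise k (B : 'M[R]_(k, N)) :
  measurable_fun [set: T] (fun w => dot (B *m noise w) (B *m noise w)).
Proof.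
have mB i : measurable_fun [set: T] (fun w => (B *m noise w) i 0).
  under eq_fun do rewrite mxE.
  apply: measurable_sum => j; under eq_fun do rewrite mxE.
  by apply: measurable_funM => //; exact: (measurable_funPT (W j)).
by rewrite /dot; apply: measurable_sum => i; exact: measurable_funM.
Qed.

Lemma chi_square_tail k (B : 'M[R]_(N, k)) (x : R) : (0 < k)%N -> 0 < x ->
  let A := N%:R^-1 *: (B^T *m B) in 0 < spectral_norm A ->
  (P [set w | (N%:R * sigma ^+ 2 * (\tr A
       + 2 * spectral_norm A * (2 * x + Num.sqrt (k%:R * x)))
       <= dot (B^T *m noise w) (B^T *m noise w))%R]
    <= (expR (- x))%:E)%E.
Proof.
move=> k0 x0 A; set rho := spectral_norm A => rho0.
have NR : 0 < N%:R :> R by rewrite ltr0n.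
have [s [sk ps s1 str sB]] := gram_orthogonalization B N_gt0.
rewrite -/A in str; rewrite -/A -/rho in s1.
set z := N%:R * sigma ^+ 2 * _.
pose sx := Num.sqrt x; pose K := Num.sqrt (k%:R : R).
have sx0 : 0 < sx by rewrite sqrtr_gt0.
have K0 : 0 < K by rewrite sqrtr_gt0 ltr0n.
have sx2 : sx ^+ 2 = x by rewrite sqr_sqrtr// ltW.
have K2 : K ^+ 2 = k%:R by rewrite sqr_sqrtr.
have D0 : 0 < K + 2 * sx by lra.
(* Chernoff's exponent is -2 sx tau (2 sx + K) + K^2 tau^2 / (1 - 2 tau);
   Laurent and Massart's tau makes it -2 x + x K / (K + 2 sx). *)
pose tau := sx / (K + 2 * sx).
have tau0 : 0 < tau by rewrite divr_gt0.
(* Chernoff's parameter, scaled so that [dot a a <= N * rho] becomes [u a <= 2 * tau]. *)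
pose r := tau / (rho * sigma ^+ 2 * N%:R).
have den0 : 0 < rho * sigma ^+ 2 * N%:R by rewrite !mulr_gt0// exprn_gt0.
have r0 : 0 < r by rewrite divr_gt0.
pose f w := dot (B^T *m noise w) (B^T *m noise w).
pose X : {RV P >-> R} := HB.pack f
  (isMeasurableFun.Build _ _ _ _ f (measurable_sqr_mulmx_noise B^T)).
apply: (le_trans (chernoff X z r0)).
(* Scaling the vectors by [c] turns [r] times the sum of squares into the half-squares of
   [integral_expR_quadratic_noise]. *)
pose c := Num.sqrt (2 * r).
have c2 : c ^+ 2 = 2 * r by rewrite sqr_sqrtr// mulr_ge0// ltW.
have dc (u v : 'cV[R]_N) : dot (c *: u) (c *: v) = 2 * r * dot u v.
  by rewrite dotZl dotZr mulrA -expr2 c2.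
pose u (a : 'cV[R]_N) := sigma ^+ 2 * dot (c *: a) (c *: a).
have uE a : u a = 2 * tau / (rho * N%:R) * dot a a.
  by rewrite /u dc /r; field; rewrite !gt_eqF.
have tau1 : 0 < 1 - 2 * tau.
  have -> : 1 - 2 * tau = K / (K + 2 * sx) by rewrite /tau; field; rewrite gt_eqF.
  by rewrite divr_gt0.
have u0 a : 0 <= u a by rewrite mulr_ge0 ?sqr_ge0 ?dotvv_ge0.
have u1 : {in s, forall a, u a <= 2 * tau}.
  move=> a /s1 aa; rewrite uE mulrAC ler_pdivrMr ?mulr_gt0//.
  by rewrite ler_pM2l ?(mulrC rho)// pmulr_rgt0.
have mgf : ('M_P X r = (\prod_(a <- s) (Num.sqrt (1 - u a))^-1)%:E)%E.
  have := @integral_expR_quadratic_noise R d T P N sigma W sigma_gt0 gaussW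
    [seq c *: a | a <- s] 0.
  rewrite dot0l mulr0 mul0r expR0 mulr1 big_map => /(_ _ _ _)/wrap[|||<-].
  - rewrite pairwise_map; apply: sub_pairwise ps => a b /= /eqP ab.
    by rewrite dc ab mulr0.
  - by move=> a _; rewrite dot0l.
  - move=> _ /mapP[a sa ->]; apply: le_lt_trans (u1 a sa) _.
    by rewrite -subr_gt0.
  rewrite /mmt_gen_fun unlock; apply: eq_integral => w _; congr (expR _)%:E.
  rewrite dot0l addr0 big_map /= /f -sB mulr_suml; apply: eq_bigr => a _.
  by rewrite dotZl exprMn c2; field.
rewrite mgf -EFinM lee_fin.
(* The linear terms [u a / 2] are kept exact, since they add up to the trace; only the quadratic
   corrections are replaced by their value at the maximum [2 * tau]. *)
have prod_le : \prod_(a <- s) (Num.sqrt (1 - u a))^-1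
    <= expR (\sum_(a <- s) (u a / 2 + (2 * tau) ^+ 2 / (4 * (1 - 2 * tau)))).
  rewrite expR_sum big_seq [leRHS]big_seq; apply: ler_prod => a sa.
  rewrite invr_ge0 sqrtr_ge0/=; have ua := u1 a sa.
  have ua1 : u a < 1 by apply: le_lt_trans ua _; rewrite -subr_gt0.
  apply: (le_trans (rsqrt_le_expR (u0 a) ua1)).
  rewrite ler_expR lerD2l ler_pM ?sqr_ge0 ?invr_ge0 ?mulr_ge0 ?subr_ge0 ?(ltW ua1)//.
    by rewrite ler_pXn2r// nnegrE// (le_trans (u0 a)).
  rewrite lef_pV2 ?posrE ?mulr_gt0 ?subr_gt0//; last by rewrite -subr_gt0.
  by rewrite ler_pM2l// lerB.
apply: (le_trans (ler_wpM2r (expR_ge0 _) prod_le)).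
rewrite -expRD ler_expR big_split/= big_const_seq count_predT sk iter_addr_0.
(* This cancels the trace part of [r * z]. *)
have -> : \sum_(a <- s) u a / 2 = tau * (\tr A) / rho.
  under eq_bigr do rewrite uE.
  by rewrite -mulr_suml -mulr_sumr str; field; rewrite !gt_eqF.
rewrite -[_ *+ k]mulr_natr -K2.
have -> : r * z = tau * (\tr A) / rho
    + 2 * tau * (2 * sx ^+ 2 + K * sx).
  by rewrite /r /z (sqrtrM _ (ler0n _ _)) -/K -/sx sx2 -/rho; field; rewrite !gt_eqF.
have -> : (2 * tau) ^+ 2 / (4 * (1 - 2 * tau)) * K ^+ 2 = sx ^+ 2 * (K / (K + 2 * sx)).
  rewrite (_ : 1 - 2 * tau = K / (K + 2 * sx)); last first.
    by rewrite /tau; field; rewrite gt_eqF.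
  by rewrite /tau; field; rewrite !gt_eqF.
have -> : 2 * tau * (2 * sx ^+ 2 + K * sx) = 2 * sx ^+ 2.
  by rewrite /tau; field; rewrite gt_eqF.
have K1 : K / (K + 2 * sx) <= 1 by rewrite ler_pdivrMr// mul1r lerDl; lra.
have : sx ^+ 2 * (K / (K + 2 * sx)) <= sx ^+ 2 * 1 by rewrite ler_pM2l// exprn_gt0.
by rewrite -sx2; lra.
Qed.

End ChiSquareTail.

(** * Group Lasso under coherence *)

Section Coherence.
Variable R : realType.

(** Pairs with equal indices contribute at most [delta * enorm u * enorm v] by Cauchy-Schwarz. The
    others contribute as much again: passing to l1 norms costs [sqrt m] and [sqrt n], which the
    factor in the hypothesis cancels. *)
Lemma normr_bilinear_le m n (A : 'M[R]_(m, n)) (delta : R) (u : 'cV[R]_m) (v : 'cV[R]_n) :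
  (0 < m)%N -> (0 < n)%N -> 0 <= delta ->
  (forall (t : 'I_m) (t' : 'I_n), t = t' :> nat -> `|A t t'| <= delta) ->
  (forall (t : 'I_m) (t' : 'I_n), t <> t' :> nat ->
     `|A t t'| <= delta * (Num.sqrt (m%:R * n%:R))^-1) ->
  `|dot u (A *m v)| <= 2 * delta * enorm u * enorm v.
Proof.
move=> m0 n0 d0 Adiag Aoff; set e := (Num.sqrt _)^-1 in Aoff.
have e0 : 0 <= e by rewrite invr_ge0 sqrtr_ge0.
pose D := \sum_(p : 'I_m * 'I_n | p.1 == p.2 :> nat) `|u p.1 0| * `|v p.2 0|.
have DE : D = \sum_(t < m) \sum_(t' < n) (if t == t' :> nat then `|u t 0| * `|v t' 0| else 0).
  rewrite pair_big /D big_mkcond; apply: eq_bigr => -[t t'] _ //=.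
have Dle : D <= enorm u * enorm v.
  have D0 : 0 <= D by apply: sumr_ge0 => p _; rewrite mulr_ge0.
  rewrite -(@ler_pXn2r _ 2) ?nnegrE ?mulr_ge0 ?enorm_ge0//.
  rewrite exprMn !sqr_enorm; apply: (le_trans (sum_mul_sqr_le _ _ _)).
  (* In a rectangular matrix an index has at most one partner with the same value, possibly none. *)
  have card1 (k l : nat) (x : R) (f : 'I_k -> 'I_l -> bool) (i : 'I_k) :
      (forall j j', f i j -> f i j' -> j = j') -> 0 <= x ->
      \sum_(j < l | f i j) x <= x.
    move=> fi x0; rewrite sumr_const -[leRHS]mulr1n; apply: ler_wpMn2l => //.
    by apply/card_le1_eqP => j j' jj jj'; exact: fi jj' jj.
  apply: ler_pM; try by apply: sumr_ge0 => p _; exact: sqr_ge0.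
    rewrite (_ : \sum_(p | _) _ = \sum_(t < m) \sum_(t' < n | t == t' :> nat) u t 0 ^+ 2).
      apply: ler_sum => t _; rewrite -expr2.
      apply: (@card1 m n _ (fun t t' => t == t' :> nat)); last exact: sqr_ge0.
      by move=> j j' /eqP jt /eqP jt'; apply: val_inj; exact: etrans (esym jt) jt'.
    rewrite pair_big_dep/=; apply: eq_bigr => -[t t'] _ /=.
    by rewrite real_normK ?num_real.
  rewrite (_ : \sum_(p | _) _ = \sum_(t' < n) \sum_(t < m | t == t' :> nat) v t' 0 ^+ 2).
    apply: ler_sum => t _; rewrite -expr2.
    apply: (@card1 n m _ (fun t' t => t == t' :> nat)); last exact: sqr_ge0.
    by move=> j j' /eqP jt /eqP jt'; apply: val_inj; exact: etrans jt (esym jt').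
  rewrite (exchange_big_dep xpredT)//= pair_big_dep/=; apply: eq_bigr => -[t t'] _ /=.
  by rewrite real_normK ?num_real.
have Sle : e * (\sum_t `|u t 0|) * (\sum_t `|v t 0|) <= enorm u * enorm v.
  have -> : enorm u * enorm v
      = e * (Num.sqrt m%:R * enorm u) * (Num.sqrt n%:R * enorm v).
    rewrite /e sqrtrM//; field; rewrite !sqrtr_eq0 -!ltNge !ltr0n; exact/andP.
  rewrite -[leLHS]mulrA -[leRHS]mulrA ler_wpM2l//.
  by apply: ler_pM; rewrite ?sumr_ge0// sum_normr_le.
rewrite /dot; apply: (le_trans (ler_norm_sum _ _ _)).
(* The second term runs over all pairs; the equal-index ones it adds are nonnegative. *)
apply: (@le_trans _ _ (delta * D + delta * (e * (\sum_t `|u t 0|) * (\sum_t `|v t 0|)))).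
  rewrite DE -mulrA mulr_suml !mulr_sumr -big_split/=.
  apply: ler_sum => t _; rewrite mxE mulr_sumr.
  apply: (le_trans (ler_norm_sum _ _ _)).
  rewrite !mulr_sumr -big_split/=; apply: ler_sum => t' _.
  have uv0 : 0 <= `|u t 0| * `|v t' 0| by rewrite mulr_ge0.
  rewrite !normrM; case: eqP => [tt|tt].
    have := Adiag _ _ tt; have : 0 <= delta * (e * (`|u t 0| * `|v t' 0|)).
      by rewrite !mulr_ge0.
    by move=> H1 /(ler_wpM2r uv0); lra.
  by have := Aoff _ _ tt => /(ler_wpM2r uv0); lra.
by have := ler_wpM2l d0 Dle; have := ler_wpM2l d0 Sle; lra.
Qed.

Variables (M K N : nat) (G : 'I_M -> {set 'I_K}) (X : 'M[R]_(N, K)).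
Hypothesis partG : group_partition G.

Lemma group_gt0 j : (0 < #|G j|)%N.
Proof.
have [_ /and3P[_ _ G0]] := partG; rewrite card_gt0; apply: contraNneq G0 => <-.
by apply/imsetP; exists j.
Qed.

Lemma group_inj (k : 'I_K) j j' : k \in G j -> k \in G j' -> j = j'.
Proof.
have [injG /and3P[_ /finset.trivIsetP tG _]] := partG => kj kj'.
apply: injG; apply/eqP; apply: contraT => /(tG _ _ (imset_f _ _) (imset_f _ _)).
by move=> /(_ isT isT) /disjoint_setI0/setP/(_ k); rewrite !inE kj kj'.
Qed.

Lemma sum_groups (F : 'I_K -> R) :
  \sum_k F k = \sum_j \sum_(t < #|G j|) F (enum_val t).
Proof.
have [injG /and3P[/eqP cG tG _]] := partG.
transitivity (\sum_(k in [set: 'I_K]%SET) F k); first by apply: eq_bigl => k; rewrite inE.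
rewrite -cG finset.big_trivIset//= big_imset/=; last by move=> j j' _ _; exact: injG.
by apply: eq_bigr => j _; rewrite -big_enum_val.
Qed.

Lemma blockE (b : 'cV[R]_K) j t : block G b j t 0 = b (enum_val t) 0.
Proof. by rewrite mxE. Qed.

Lemma blockD (u v : 'cV[R]_K) j : block G (u + v) j = block G u j + block G v j.
Proof. by apply/matrixP => t i; rewrite !mxE. Qed.

Lemma blockZ a (v : 'cV[R]_K) j : block G (a *: v) j = a *: block G v j.
Proof. by apply/matrixP => t i; rewrite !mxE. Qed.

Lemma blockB (u v : 'cV[R]_K) j : block G (u - v) j = block G u j - block G v j.
Proof. by rewrite -scaleN1r blockD blockZ scaleN1r. Qed.

Lemma dot_block (u v : 'cV[R]_K) : dot u v = \sum_j dot (block G u j) (block G v j).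
Proof.
rewrite /dot sum_groups; apply: eq_bigr => j _; apply: eq_bigr => t _.
by rewrite !blockE.
Qed.

Lemma block_mulmx_tr (r : 'cV[R]_N) j :
  block G (X^T *m r) j = (subdesign G X j)^T *m r.
Proof. by apply/matrixP => t i; rewrite !mxE; apply: eq_bigr => l _; rewrite !mxE. Qed.

Lemma mulmx_block (v : 'cV[R]_K) : X *m v = \sum_j subdesign G X j *m block G v j.
Proof.
apply/matrixP => i l; rewrite ord1 summxE mxE sum_groups; apply: eq_bigr => j _.
by rewrite mxE; apply: eq_bigr => t _; rewrite !mxE.
Qed.

Lemma restrict_block (J : {set 'I_M}) (b : 'cV[R]_K) j :
  block G (restrict_groups G J b) j = if j \in J then block G b j else 0.
Proof.
case: ifPn => jJ; apply/matrixP => t i; rewrite ord1 !mxE.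
  by rewrite ifT//; apply/existsP; exists j; rewrite jJ; exact: enum_valP.
case: ifP => // /existsP[j' /andP[j'J tj']].
by have E := group_inj (enum_valP t) tj'; rewrite -E (negPf jJ) in j'J.
Qed.

Let Psi (v : 'cV[R]_K) : 'cV[R]_K := N%:R^-1 *: (X^T *m (X *m v)).

Lemma block_gram (v : 'cV[R]_K) j :
  block G (Psi v) j = \sum_j' gram G X j j' *m block G v j'.
Proof.
rewrite blockZ block_mulmx_tr mulmx_block mulmx_sumr scaler_sumr.
by apply: eq_bigr => j' _; rewrite /gram -scalemxAl mulmxA.
Qed.

Variables (lambda : 'I_M -> R) (s : nat) (alpha phi : R).
Let delta := coherence_level lambda s alpha phi.
Hypotheses (delta_ge0 : 0 <= delta) (coh : coherence_assumption G X lambda s alpha phi).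

(** [normr_bilinear_le] applies to each Gram block once [phi] is subtracted from the diagonal one,
    whose diagonal then vanishes; within a group [sqrt (K_j * K_j) = K_j] matches the two forms of
    the off-diagonal bound. *)
Lemma coherence_dot_block (v : 'cV[R]_K) j (u : 'cV[R]_#|G j|) :
  `|dot u (block G (Psi v) j) - phi * dot u (block G v j)|
    <= 2 * delta * enorm u * \sum_j' enorm (block G v j').
Proof.
have [coh1 coh2] := coh.
rewrite block_gram dot_sumr (bigD1 j)//= addrAC.
have -> : dot u (gram G X j j *m block G v j) - phi * dot u (block G v j)
    = dot u ((gram G X j j - phi%:M) *m block G v j).
  by rewrite mulmxBl mul_scalar_mx dotBr dotZr.
apply: (le_trans (ler_normD _ _)).
have gE t t' : (gram G X j j - phi%:M) t t' = gram G X j j t t' - phi *+ (t == t').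
  by rewrite !mxE.
rewrite [X in _ <= _ * X](bigD1 j)//= mulrDr mulr_sumr; apply: lerD.
  apply: normr_bilinear_le; rewrite ?group_gt0//.
    move=> t t' /val_inj <-; have [cd _] := coh1 j.
    by rewrite gE eqxx cd mulr1n subrr normr0.
  move=> t t' tt; have [_ co] := coh1 j.
  have tt' : t != t' by apply/eqP => E; apply: tt; rewrite E.
  rewrite gE (negPf tt') mulr0n subr0 -expr2 sqrtr_sqr normr_nat; exact: co.
apply: (le_trans (ler_norm_sum _ _ _)); apply: ler_sum => j' jj'.
have [|cd co] := coh2 j j'; first by rewrite eq_sym.
by apply: normr_bilinear_le; rewrite ?group_gt0.
Qed.

Lemma coherence_form (u v : 'cV[R]_K) :
  `|N%:R^-1 * dot (X *m u) (X *m v) - phi * dot u v|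
    <= 2 * delta * (\sum_j enorm (block G u j)) * \sum_j enorm (block G v j).
Proof.
have -> : N%:R^-1 * dot (X *m u) (X *m v) = dot u (Psi v).
  by rewrite dotZr dotC dot_mulmxr dotC.
rewrite !dot_block mulr_sumr -sumrB; apply: (le_trans (ler_norm_sum _ _ _)).
rewrite [X in _ <= X * _]mulr_sumr mulr_suml; apply: ler_sum => j _.
exact: coherence_dot_block.
Qed.

End Coherence.

(** * Deterministic error analysis on the noise event *)

Section Lasso.
Variables (R : realType) (M K N : nat) (G : 'I_M -> {set 'I_K}) (X : 'M[R]_(N, K)).
Variables (lambda : 'I_M -> R) (betastar b : 'cV[R]_K) (e : 'cV[R]_N).
Hypotheses (N_gt0 : (0 < N)%N) (partG : group_partition G).
Hypothesis lambda_gt0 : forall j, 0 < lambda j.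
Hypothesis noise_le : forall j,
  enorm ((subdesign G X j)^T *m e) <= N%:R * (lambda j / 2).
Hypothesis solb : group_lasso_solution G X lambda (X *m betastar + e) b.

Let D := b - betastar.
Let J := active_groups G betastar.
Let NR : 0 < N%:R :> R. Proof. by rewrite ltr0n. Qed.

Lemma lasso_basic_inequality :
  N%:R^-1 * dot (X *m D) (X *m D) + \sum_j lambda j * enorm (block G D j)
    <= 4 * \sum_(j in J) lambda j * enorm (block G D j).
Proof.
have := solb betastar; rewrite /group_lasso_objective.
rewrite (_ : X *m betastar - (X *m betastar + e) = - e); last first.
  by rewrite opprD addrA subrr sub0r.
rewrite enormN !sqr_enorm.
have -> : X *m b - (X *m betastar + e) = X *m D - e.
  by rewrite mulmxBr opprD addrA.
rewrite dotvvB.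
have noise : dot (X *m D) e <= N%:R / 2 * \sum_j lambda j * enorm (block G D j).
  rewrite dotC dot_mulmxr (dot_block partG) mulr_sumr; apply: ler_sum => j _.
  rewrite block_mulmx_tr; apply: (le_trans (dot_le _ _)).
  have := ler_wpM2r (enorm_ge0 (block G D j)) (noise_le j); lra.
have N1 : N%:R^-1 * (dot (X *m D) (X *m D) - 2 * dot (X *m D) e + dot e e)
    = N%:R^-1 * dot (X *m D) (X *m D) - 2 * (N%:R^-1 * dot (X *m D) e)
      + N%:R^-1 * dot e e by ring.
have noise' : 2 * (N%:R^-1 * dot (X *m D) e) <= \sum_j lambda j * enorm (block G D j).
  by rewrite mulrCA mulrC ler_pdivrMr//; lra.
rewrite N1 => main.
(* The first sum is added to both sides of the comparison: off the support the terms then cancel,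
   and on it the triangle inequality gives the factor 2. *)
have pen : \sum_j lambda j * enorm (block G D j)
    + \sum_j lambda j * enorm (block G betastar j)
    - \sum_j lambda j * enorm (block G b j)
    <= 2 * \sum_(j in J) lambda j * enorm (block G D j).
  rewrite -big_split -sumrB mulr_sumr [leRHS]big_mkcond/=; apply: ler_sum => j _.
  have Dj : block G D j = block G b j - block G betastar j by rewrite blockB.
  case: ifPn => [_|].
    have tri : enorm (block G betastar j) <= enorm (block G D j) + enorm (block G b j).
      have := enormB_le (block G betastar j) (block G b j).
      by rewrite -[enorm (_ - _)]enormN opprB -Dj; lra.
    have := ler_wpM2l (ltW (lambda_gt0 j)) tri; lra.
  rewrite inE negbK => /eqP bj; rewrite Dj bj subr0 enorm0; lra.
by lra.
Qed.

Lemma lasso_cone :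
  \sum_(j | j \notin J) lambda j * enorm (block G D j)
    <= 3 * \sum_(j in J) lambda j * enorm (block G D j).
Proof.
have := lasso_basic_inequality; rewrite (bigID (mem J))/=.
have : 0 <= N%:R^-1 * dot (X *m D) (X *m D).
  by rewrite mulr_ge0 ?dotvv_ge0// invr_ge0 ltW.
by lra.
Qed.

(** First-order optimality without subdifferentials: along [h], the [j]-th block of [g], the penalty
    grows by at most [2 * t * lambda j * c], while the quadratic part falls by [2 * t * c ^+ 2 / N]
    up to order [t ^+ 2]. *)
Lemma lasso_kkt j :
  enorm (block G (X^T *m (X *m betastar + e - X *m b)) j) <= N%:R * lambda j.
Proof.
set r := X *m betastar + e - X *m b; set g := X^T *m r.
pose h := restrict_groups G [set j]%SET g.
have [c cE] : exists c, c = enorm (block G g j) by eexists.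
have hj i : block G h i = if i == j then block G g i else 0.
  by rewrite restrict_block// inE.
have Xhr : dot (X *m h) r = c ^+ 2.
  rewrite dotC dot_mulmxr (dot_block partG) (bigD1 j)//= big1 => [|i ij].
    by rewrite addr0 hj eqxx -sqr_enorm cE.
  by rewrite hj (negPf ij) dot0r.
have pen (t : R) : 0 <= t -> \sum_i lambda i * enorm (block G (b + t *: h) i)
    <= \sum_i lambda i * enorm (block G b i) + t * (lambda j * c).
  move=> t0; have -> : t * (lambda j * c) = \sum_i t * (lambda i * enorm (block G h i)).
    rewrite (bigD1 j)//= big1 => [|i ij]; first by rewrite addr0 hj eqxx cE.
    by rewrite hj (negPf ij) enorm0 !mulr0.
  rewrite -big_split; apply: ler_sum => i _ /=; rewrite mulrCA -mulrDr.
  rewrite ler_pM2l// blockD blockZ; apply: (le_trans (enormD_le _ _)).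
  by rewrite enormZ ger0_norm.
have step (t : R) : 0 < t ->
    2 * (c ^+ 2 - N%:R * lambda j * c) <= t * dot (X *m h) (X *m h).
  move=> t0; have := solb (b + t *: h); rewrite /group_lasso_objective !sqr_enorm.
  have -> : X *m b - (X *m betastar + e) = - r by rewrite opprB.
  have -> : X *m (b + t *: h) - (X *m betastar + e) = t *: (X *m h) - r.
    by rewrite mulmxDr -scalemxAr opprB addrCA addrA.
  have -> : dot (- r) (- r) = dot r r by rewrite dotNl dotNr opprK.
  have -> : dot (t *: (X *m h) - r) (t *: (X *m h) - r)
      = t ^+ 2 * dot (X *m h) (X *m h) - 2 * t * c ^+ 2 + dot r r.
    by rewrite dotvvB !dotZl !dotZr Xhr; ring.
  move=> H; have := pen t (ltW t0) => Hp.
  have H2 : 0 <= N%:R^-1 * (t ^+ 2 * dot (X *m h) (X *m h) - 2 * t * c ^+ 2)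
      + 2 * (t * (lambda j * c)).
    move: H Hp; rewrite [N%:R^-1 * (_ + _)]mulrDr.
    by set p1 := N%:R^-1 * dot r r; set p2 := N%:R^-1 * (_ - _); lra.
  have : 0 <= N%:R / t * (N%:R^-1 * (t ^+ 2 * dot (X *m h) (X *m h) - 2 * t * c ^+ 2)
      + 2 * (t * (lambda j * c))) by rewrite mulr_ge0// divr_ge0 ?ltW.
  have -> : N%:R / t * (N%:R^-1 * (t ^+ 2 * dot (X *m h) (X *m h) - 2 * t * c ^+ 2)
      + 2 * (t * (lambda j * c)))
    = t * dot (X *m h) (X *m h) - 2 * c ^+ 2 + 2 * N%:R * lambda j * c.
    by field; rewrite !gt_eqF.
  by lra.
have c0 : 0 <= c by rewrite cE enorm_ge0.
rewrite -cE leNgt; apply/negP => lc.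
have a0 : 0 < 2 * (c ^+ 2 - N%:R * lambda j * c).
  rewrite expr2 -mulrBl mulr_gt0// mulr_gt0 ?subr_gt0//.
  by rewrite (lt_trans _ lc)// mulr_gt0.
move: a0 step (dotvv_ge0 (X *m h)).
move: (2 * _) (dot (X *m h) _) => a y a0 step y0.
have y1 : 0 < y + 1 by lra.
(* This [t] gives [t * y < a], against [step]. *)
have := step (a / (y + 1)) (divr_gt0 a0 y1).
rewrite mulrAC ler_pdivlMr// ler_pM2l//; lra.
Qed.

(** [X *m D] is the noise minus the residual: the noise contributes [lambda j / 2], and [lasso_kkt]
    bounds the residual part by [lambda j]. *)
Lemma lasso_gram_error_le j :
  enorm (block G (N%:R^-1 *: (X^T *m (X *m D))) j) <= 3 / 2 * lambda j.
Proof.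
have -> : X *m D = e - (X *m betastar + e - X *m b).
  by rewrite mulmxBr opprB addrCA opprD [e + _]addrCA subrr addr0.
rewrite mulmxBr blockZ blockB enormZ ger0_norm ?invr_ge0 ?ler0n//.
rewrite mulrC ler_pdivrMr//.
apply: (le_trans (enormD_le _ _)); rewrite enormN block_mulmx_tr.
have := lasso_kkt j; have := noise_le j; lra.
Qed.

Variables (s : nat) (alpha phi : R).
Hypotheses (s_gt0 : (0 < s)%N) (sparse : (#|J| <= s)%N).
Hypotheses (alpha_gt1 : 1 < alpha) (phi_gt0 : 0 < phi).
Hypothesis coh : coherence_assumption G X lambda s alpha phi.

Lemma lambda_le_max j : lambda j <= lambda_max lambda.
Proof. exact: le_bigmax. Qed.

Lemma lambda_min_le j : lambda_min lambda <= lambda j.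
Proof. exact: bigmin_le. Qed.

Lemma lambda_max_gt0 (j : 'I_M) : 0 < lambda_max lambda.
Proof. exact: lt_le_trans (lambda_gt0 j) (lambda_le_max j). Qed.

Lemma lambda_min_gt0 (j : 'I_M) : 0 < lambda_min lambda.
Proof.
by apply: lt_bigmin => [|i _]; [exact: lambda_max_gt0 j|exact: lambda_gt0].
Qed.

Lemma lasso_block_error_le j :
  enorm (block G D j)
    <= (3 / 2 + 16 / (7 * (alpha - 1))) / phi * lambda_max lambda.
Proof.
have lM := lambda_max_gt0 j; have lm := lambda_min_gt0 j.
have lmM : lambda_min lambda <= lambda_max lambda.
  exact: le_trans (lambda_min_le j) (lambda_le_max j).
set L : R := lambda_max lambda in lM lmM *; set l : R := lambda_min lambda in lm lmM.
pose a i : R := enorm (block G D i).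
have a0 i : 0 <= a i by exact: enorm_ge0.
pose SJ : R := \sum_(i in J) a i; pose SC : R := \sum_(i | i \notin J) a i.
have SJ0 : 0 <= SJ by apply: sumr_ge0.
have SC0 : 0 <= SC by apply: sumr_ge0.
have Stot : \sum_i enorm (block G D i) = SJ + SC by rewrite (bigID (mem J)).
have SJL : \sum_(i in J) lambda i * a i <= L * SJ.
  by rewrite mulr_sumr; apply: ler_sum => i _; rewrite ler_wpM2r// lambda_le_max.
have SCl : l * SC <= \sum_(i | i \notin J) lambda i * a i.
  by rewrite mulr_sumr; apply: ler_sum => i _; rewrite ler_wpM2r// lambda_min_le.
have cone : \sum_(i | i \notin J) lambda i * a i <= 3 * \sum_(i in J) lambda i * a i.
  exact: lasso_cone.
have SCcone : l * SC <= 3 * L * SJ by lra.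
have sR : 0 < s%:R :> R by rewrite ltr0n.
have aR : 0 < alpha by exact: lt_trans ltr01 alpha_gt1.
have a1R : 0 < alpha - 1 by rewrite subr_gt0.
pose delta : R := coherence_level lambda s alpha phi.
have deltaE : delta = l * phi / (14 * alpha * L * s%:R) by [].
have delta0 : 0 <= delta by rewrite deltaE divr_ge0 ?mulr_ge0// ltW.
(* [DJ] and [DC] are orthogonal, so coherence makes their cross term in the Gram form small. *)
pose DJ := restrict_groups G J D; pose DC := D - DJ.
have bJ i : block G DJ i = if i \in J then block G D i else 0.
  exact: restrict_block.
have bC i : block G DC i = if i \in J then 0 else block G D i.
  by rewrite blockB bJ; case: ifP; rewrite ?subrr ?subr0.
pose U : R := dot DJ DJ.
have U0 : 0 <= U by exact: dotvv_ge0.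
have sumJ : \sum_i enorm (block G DJ i) = SJ.
  rewrite /SJ [RHS]big_mkcond; apply: eq_bigr => i _; rewrite bJ.
  by case: ifP => //; rewrite enorm0.
have sumC : \sum_i enorm (block G DC i) = SC.
  rewrite /SC [RHS]big_mkcond; apply: eq_bigr => i _; rewrite bC.
  by case: ifP => //; rewrite enorm0.
have UE : U = \sum_(i in J) a i ^+ 2.
  rewrite /U (dot_block partG) [RHS]big_mkcond; apply: eq_bigr => i _.
  by rewrite bJ; case: ifP => _; rewrite ?dot0l// sqr_enorm.
have SJU : SJ ^+ 2 <= s%:R * U.
  have := sum_mul_sqr_le (mem J) (fun=> 1) a.
  under eq_bigr do rewrite mul1r.
  rewrite expr1n sumr_const -UE -/SJ => H; apply: (le_trans H).
  by rewrite ler_wpM2r// ler_nat.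
have dJC : dot DJ DC = 0.
  rewrite (dot_block partG) big1// => i _; rewrite bJ bC.
  by case: ifP; rewrite ?dot0l ?dot0r.
have QJ : phi * U - 2 * delta * SJ ^+ 2 <= N%:R^-1 * dot (X *m DJ) (X *m DJ).
  have := coherence_form partG delta0 coh DJ DJ.
  by rewrite sumJ ler_norml => /andP[H _]; rewrite -/delta -/U in H; lra.
have QC : - (2 * delta * SJ * SC) <= N%:R^-1 * dot (X *m DJ) (X *m DC).
  have := coherence_form partG delta0 coh DJ DC.
  by rewrite dJC sumJ sumC mulr0 subr0 ler_norml => /andP[].
(* The basic inequality without the nonnegative form in [DC] and the weighted sum on its left
   side. *)
have Q : N%:R^-1 * dot (X *m DJ) (X *m DJ)
    + 2 * (N%:R^-1 * dot (X *m DJ) (X *m DC)) <= 4 * (L * SJ).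
  have QD : 0 <= N%:R^-1 * dot (X *m DC) (X *m DC).
    by rewrite mulr_ge0 ?dotvv_ge0// invr_ge0 ltW.
  have S0 : 0 <= \sum_i lambda i * enorm (block G D i).
    by apply: sumr_ge0 => i _; rewrite mulr_ge0 ?enorm_ge0 ?(ltW (lambda_gt0 i)).
  have : N%:R^-1 * dot (X *m D) (X *m D) + \sum_j lambda j * enorm (block G D j)
      <= 4 * \sum_(j in J) lambda j * a j by exact: lasso_basic_inequality.
  have -> : X *m D = X *m DJ + X *m DC by rewrite -mulmxDr addrCA subrr addr0.
  rewrite dotDl !dotDr (dotC (X *m DC) (X *m DJ)) => H.
  have := SJL; lra.
(* The ratio [l / L] inside [delta] pays for the factor [L / l] that is lost when the cone condition
   is freed of its weights. *)
have deltaL : delta * L = l * (phi / (14 * alpha * s%:R)).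
  by rewrite deltaE; field; rewrite !gt_eqF.
pose k : R := phi / (14 * alpha * s%:R).
have k0 : 0 < k by rewrite divr_gt0 ?mulr_gt0.
have deltak : delta <= k.
  rewrite -(ler_pM2r lM) deltaL -/k mulrC ler_pM2l//.
have dSC : delta * SC <= 3 * k * SJ.
  rewrite -(ler_pM2l lm); have := ler_wpM2l delta0 SCcone.
  rewrite (_ : delta * (3 * L * SJ) = 3 * (delta * L) * SJ); last by ring.
  by rewrite deltaL -/k; lra.
(* [phi = 14 * k * alpha * s], and the coherence losses are [2 * k * s * U] (within [J]) and
   [12 * k * s * U] (cross term): together 14, which leaves the factor [alpha - 1]. *)
have lowU : 14 * k * (alpha - 1) * s%:R * U <= 4 * L * SJ.
  have E1 : phi * U = 14 * k * alpha * (s%:R * U).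
    by rewrite /k; field; rewrite !gt_eqF.
  have E2 : 2 * delta * SJ ^+ 2 <= 2 * k * (s%:R * U).
    apply: (@le_trans _ _ (2 * k * SJ ^+ 2)); last by rewrite ler_pM2l// mulr_gt0.
    by rewrite ler_wpM2r ?sqr_ge0// ler_pM2l.
  have E3 : 4 * delta * SJ * SC <= 12 * k * (s%:R * U).
    apply: (@le_trans _ _ (12 * k * SJ ^+ 2)); last by rewrite ler_pM2l// mulr_gt0.
    by have := ler_wpM2l SJ0 dSC; lra.
  by lra.
have SJle : 14 * k * (alpha - 1) * SJ <= 4 * L.
  have [SJ00|SJn0] := eqVneq SJ 0; first by rewrite SJ00 mulr0 mulr_ge0// ltW.
  have SJp : 0 < SJ by rewrite lt_neqAle eq_sym SJn0.
  rewrite -(ler_pM2r SJp); apply: le_trans lowU.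
  have c0 : 0 <= 14 * k * (alpha - 1) by apply/ltW/mulr_gt0 => //; exact: mulr_gt0.
  by have := ler_wpM2l c0 SJU; lra.
(* [2 * k * SJ] from [SJ] and [6 * k * SJ] from [SC]; then [SJle] gives [8 * 4 / 14 = 16 / 7]. *)
have dS : 2 * delta * (SJ + SC) <= 16 / (7 * (alpha - 1)) * L.
  apply: (@le_trans _ _ (8 * k * SJ)).
    by have := ler_wpM2r SJ0 deltak; lra.
  rewrite [leRHS]mulrAC ler_pdivlMr ?mulr_gt0//.
  lra.
(* The block of the Gram error is paired with the block of [D] itself, and [a j] is divided out. *)
have main : phi * a j <= 3 / 2 * L + 2 * delta * (SJ + SC).
  have [aj0|ajn0] := eqVneq (a j) 0.
    by have := mulr_ge0 delta0 (addr_ge0 SJ0 SC0); rewrite aj0; lra.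
  have ajp : 0 < a j by rewrite lt_neqAle eq_sym ajn0 a0.
  rewrite -(ler_pM2r ajp).
  have := coherence_dot_block partG delta0 coh D (block G D j).
  rewrite Stot -sqr_enorm ler_norml -/(a j) => /andP[H _].
  have := dot_le (block G D j) (block G (N%:R^-1 *: (X^T *m (X *m D))) j).
  have := lasso_gram_error_le j => /(ler_wpM2l (a0 j)).
  have := ler_wpM2l (a0 j) (lambda_le_max j).
  by rewrite -/(a j) -/L -/delta in H *; lra.
rewrite -/(a j) [leRHS]mulrAC ler_pdivlMr// mulrC; apply: (le_trans main); lra.
Qed.

End Lasso.

(** * The noise event *)

Section GoodEvent.
Variables (R : realType) (d : measure_display) (T : measurableType d).
Variables (P : probability T R) (M K N : nat) (G : 'I_M -> {set 'I_K}).
Variables (X : 'M[R]_(N, K)) (sigma q phi : R) (W : 'I_N -> {RV P >-> R}).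
Variable lambda : 'I_M -> R.
Hypotheses (N_gt0 : (0 < N)%N) (M_gt1 : (1 < M)%N) (partG : group_partition G).
Hypotheses (sigma_gt0 : 0 < sigma) (gaussW : iid_centered_normal sigma W).
Hypotheses (q_gt0 : 0 < q) (phi_gt0 : 0 < phi).
Hypothesis lambda_gt0 : forall j, 0 < lambda j.
Hypothesis lambda_ge : forall j,
  2 * sigma / Num.sqrt N%:R
    * Num.sqrt (\tr (gram G X j j)
                + 2 * spectral_norm (gram G X j j)
                  * (2 * q * ln M%:R + Num.sqrt (#|G j|%:R * q * ln M%:R)))
  <= lambda j.
Hypothesis gram_diag : forall j t, gram G X j j t t = phi.

Let noise w : 'cV[R]_N := \col_(i < N) W i w.
Let good := [set w | forall j,
  enorm ((subdesign G X j)^T *m noise w) <= N%:R * (lambda j / 2)].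

(** A coordinate vector [v] has unit norm and [dot v (gram G X j j *m v) = phi], so the norm is at
    least [phi]. *)
Lemma spectral_norm_gram_gt0 j : 0 < spectral_norm (gram G X j j).
Proof.
pose t := Ordinal (group_gt0 partG j).
pose v : 'cV[R]_#|G j| := delta_mx t 0.
have dv u : dot v u = u t 0.
  rewrite /dot (bigD1 t)//= big1 => [|i it]; first by rewrite !mxE !eqxx mul1r addr0.
  by rewrite mxE (negPf it) mul0r.
have v1 : enorm v = 1.
  by apply/eqP; rewrite -(@eqrXn2 _ 2)// ?enorm_ge0// sqr_enorm dv mxE !eqxx expr1n.
apply: (lt_le_trans phi_gt0).
have -> : phi = dot v (gram G X j j *m v) by rewrite dv -colE mxE gram_diag.
apply: (le_trans (dot_le _ _)); rewrite v1 mul1r.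
by apply: enorm_mulmx_le_spectral_norm; rewrite v1.
Qed.

(** Union bound over the [M] groups at level [x = q * ln M]: each bad event has probability at most
    [expR (- x)], the [-q]-th power of [M]. The total is half of what the statement allows. *)
Lemma good_event : with_probability_at_least P (1 - 2 * (M%:R `^ (1 - q))) good.
Proof.
have M0 : 0 < M%:R :> R by rewrite ltr0n ltnW.
pose x := q * ln M%:R : R.
have x0 : 0 < x by rewrite mulr_gt0// ln_gt0// ltr1n.
pose z j := N%:R * sigma ^+ 2 * (\tr (gram G X j j)
       + 2 * spectral_norm (gram G X j j) * (2 * x + Num.sqrt (#|G j|%:R * x))).
pose sq j w := dot ((subdesign G X j)^T *m noise w) ((subdesign G X j)^T *m noise w).
pose B j := [set w | z j <= sq j w].
have mB j : measurable (B j).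
  have msq : measurable_fun [set: T] (sq j) by exact: measurable_sqr_mulmx_noise.
  rewrite -[B j]setTI (_ : B j = sq j @^-1` `[z j, +oo[%classic).
    by apply: msq => //; exact: measurable_itv.
  by apply/seteqP; split => w; rewrite /B/= in_itv/= andbT.
have PB j : (P (B j) <= (expR (- x))%:E)%E.
  apply: (chi_square_tail N_gt0 sigma_gt0 gaussW (B := subdesign G X j)) => //.
    exact: group_gt0.
  exact: spectral_norm_gram_gt0.
pose U := \bigcup_(j in [set` enum 'I_M]) B j.
have mU : measurable U by apply: fin_bigcup_measurable => //; exact: finite_seq.
exists (~` U); split; first exact: measurableC.
- have PU : (P U <= (M%:R * expR (- x))%:E)%E.
    apply: (le_trans (content_sub_fsum _ (finite_seq _) _ mU (@subset_refl _ U))) => //.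
    rewrite -fsbig_seq ?enum_uniq// big_enum/=.
    rewrite (_ : (M%:R * expR (- x))%:E = \sum_(j < M) (expR (- x))%:E)%E.
      by apply: lee_sum => j _; exact: PB.
    by rewrite sumEFin sumr_const card_ord mulr_natl.
  have powE : M%:R `^ (1 - q) = M%:R * expR (- x).
    rewrite /powR gt_eqF// mulrBl mul1r expRD lnK//.
  rewrite probability_setC// -(@fineK _ (P U)) ?fin_num_measure//.
  rewrite -EFinB lee_fin lerD2l lerN2 powE -lee_fin fineK ?fin_num_measure//.
  apply: (le_trans PU); rewrite lee_fin ler_peMl ?ler1n//.
move=> w nB j /=.
have {nB} : sq j w < z j.
  rewrite ltNge; apply/negP => Bj; apply: nB; exists j => //=.
  by rewrite mem_enum.
rewrite /z; set E := (_ + _ * _) => zj.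
have c0 : 0 < N%:R * sigma ^+ 2 by rewrite mulr_gt0 ?exprn_gt0 ?ltr0n.
(* Needed for the squared root of [E] to be [E]; it follows from [z j] exceeding a squared norm. *)
have E0 : 0 <= E.
  by rewrite -(pmulr_rge0 _ c0) (le_trans _ (ltW zj))// dotvv_ge0.
have NR : 0 < N%:R :> R by rewrite ltr0n.
rewrite -(@ler_pXn2r _ 2) ?nnegrE ?enorm_ge0 ?mulr_ge0 ?(ltW (lambda_gt0 j))//.
rewrite sqr_enorm; apply: (le_trans (ltW zj)).
have := lambda_ge j; rewrite -[2 * q * _]mulrA -[_ * q * _]mulrA -/x -/E => lE.
have : (2 * sigma / Num.sqrt N%:R * Num.sqrt E) ^+ 2 <= lambda j ^+ 2.
  rewrite ler_pXn2r ?nnegrE ?(ltW (lambda_gt0 j))//.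
  by rewrite !mulr_ge0 ?invr_ge0 ?sqrtr_ge0 ?(ltW sigma_gt0).
(* The squared lower bound on [lambda j] is [4 * sigma ^+ 2 * E / N], and [z j] is exactly
   [N ^+ 2 / 4] times it. *)
rewrite [X in X <= _ -> _](_ : _ = 2 ^+ 2 * sigma ^+ 2 * N%:R^-1 * E); last first.
  by rewrite !exprMn exprVn !sqr_sqrtr// ?ler0n.
move=> H; have -> : N%:R * sigma ^+ 2 * E
    = N%:R ^+ 2 / 4 * (2 ^+ 2 * sigma ^+ 2 * N%:R^-1 * E) by field; rewrite gt_eqF.
rewrite exprMn (_ : (lambda j / 2) ^+ 2 = lambda j ^+ 2 / 4); last by field.
by rewrite -[leLHS]mulrA ler_pM2l ?exprn_gt0// mulrC ler_pM2r ?invr_gt0.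
Qed.

End GoodEvent.

(** * Sup-norm error and recovery of the sparsity pattern *)

Theorem theorem5p1 (R : realType)
    (d : measure_display) (T : measurableType d) (P : probability T R)
    (N K M : nat) (hN : (1 <= N)%N) (hM : (2 <= M)%N) (hMK : (M <= K)%N)
    (G : 'I_M -> {set 'I_K}) (hG : group_partition G)
    (X : 'M[R]_(N, K)) (betastar : 'cV[R]_K)
    (sigma : R) (hsigma : 0 < sigma)
    (W : 'I_N -> {RV P >-> R}) (hW : iid_centered_normal sigma W)
    (y : T -> 'cV[R]_N)
    (hy : forall w : T, y w = X *m betastar + \col_(i < N) W i w)
    (q : R) (hq : 0 < q)
    (lambda : 'I_M -> R) (hlambda_pos : forall j : 'I_M, 0 < lambda j)
    (hlambda : forall j : 'I_M,
       2 * sigma / Num.sqrt N%:R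
         * Num.sqrt (\tr (gram G X j j)
                     + 2 * spectral_norm (gram G X j j)
                       * (2 * q * ln M%:R
                          + Num.sqrt (#|G j|%:R * q * ln M%:R)))
       <= lambda j)
    (s : nat) (hs1 : (1 <= s)%N) (hsM : (s <= M)%N)
    (hsparse : (#|active_groups G betastar| <= s)%N)
    (hRE : assumption_RE G X lambda s)
    (alpha phi : R) (halpha : 1 < alpha) (hphi : 0 < phi)
    (hcoh : coherence_assumption G X lambda s alpha phi) :
  let c : R := 3 / 2 + 16 / (7 * (alpha - 1)) in
  let p : R := 1 - 2 * (M%:R `^ (1 - q)) in
  with_probability_at_least P p
    [set w | forall b : 'cV[R]_K, group_lasso_solution G X lambda (y w) b ->
       norm2inf G (b - betastar) <= c / phi * lambda_max lambda]%classic
  /\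
  ((forall j : 'I_M, j \in active_groups G betastar ->
      2 * c / phi * lambda_max lambda < enorm (block G betastar j)) ->
   with_probability_at_least P p
     [set w | forall b : 'cV[R]_K, group_lasso_solution G X lambda (y w) b ->
        [set j : 'I_M | c / phi * lambda_max lambda < enorm (block G b j)]%SET
          = active_groups G betastar]%classic).
Proof.
move=> c p.
pose good := [set w : T | forall j,
  enorm ((subdesign G X j)^T *m \col_(i < N) W i w) <= N%:R * (lambda j / 2)].
have good_prob : with_probability_at_least P p good.
  apply: (good_event hN hM hG hsigma hW hq hphi hlambda_pos hlambda) => j t.
  by have [/(_ j)[]] := hcoh.
have good_error w b j : good w -> group_lasso_solution G X lambda (y w) b ->
    enorm (block G (b - betastar) j) <= c / phi * lambda_max lambda.
  move=> gw; rewrite hy => sol.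
  exact: (lasso_block_error_le hN hG hlambda_pos gw sol hs1 hsparse halpha hphi hcoh).
have [A [mA PA goodA]] := good_prob.
(* One event serves both claims and all solutions, as the error bound is deterministic on it. *)
split=> [|beta_min]; exists A; split=> // w /goodA gw b sol.
  apply: bigmax_le => [|j _]; last exact: good_error gw sol.
  (* The default value 0 of the maximum must also lie below the bound; any existing group shows
     this. *)
  exact: le_trans (enorm_ge0 _) (good_error w b (Ordinal hM) gw sol).
apply/setP => j; rewrite !inE; have := good_error w b j gw sol.
(* Off the support the error is the block of [b] itself, hence below the threshold; on it, a block
   of norm above twice the threshold loses at most one threshold. *)
rewrite blockB => err; apply/idP/idP => [bj|bj].
  apply: contraTneq bj => bj0; rewrite -leNgt.
  by move: err; rewrite bj0 subr0.
have := beta_min j; rewrite inE => /(_ bj).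
have := enormB_le (block G betastar j) (block G b j).
rewrite -[enorm (_ - _)]enormN opprB => H1 H2.
have H3 : 2 * c / phi * lambda_max lambda = 2 * (c / phi * lambda_max lambda) by ring.
by rewrite H3 in H2; lra.
Qed.
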